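(* Let $k\ge1$ and let $U:\mathbb{Z}^k\to[0,\infty)$ be a symmetric function (gradient interaction potential, $U(-j)=U(j)$) with $U(0)=0$ and $v:=\inf_{j\in\mathbb{Z}^k\setminus\{0\}}U(j)>0$. Let $A>\frac1v$ be fixed, set $\beta_{A,d}:=A\log d/(d+1)$ for integers $d\ge 2$, and set $Q_\beta:=\exp(-\beta U)$ for $\beta>0$. Assume that $\Vert Q_{\beta_{A,d}}\Vert_{\frac{d+1}{2},\mathbb{Z}^k}<\infty$ for some $d\ge2$. Then: 1. There is a minimal degree $d_0\ge2$ such that for all $d\ge d_0$ and all $\beta\ge\beta_{A,d}$ there is a family $(\mu_i)_{i\in\mathbb{Z}^k}$ of distinct tree-automorphism invariant Gibbs measures for the transfer operator $Q_\beta$ on the Cayley tree $\Gamma^d$. 2. In this range the measures $\mu_i$ satisfy $$\frac{\mu_i(\sigma_0\ne i)}{\mu_i(\sigma_0=i)}\le C\,\frac1d\xrightarrow{d\to\infty}0,$$ where $C>0$ is some constant.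
   Context: The Cayley tree $\Gamma^d=(V,L)$ of order $d$ is the infinite connected graph without cycles in which every vertex has exactly $d+1$ neighbours. $0\in V$ is a fixed vertex and $\sigma_x$ are the coordinate maps on $(\mathbb{Z}^k)^V$. For $\Lambda\subset V$, $\partial\Lambda$ is its outer boundary. A Gibbs measure for $Q$ is a probability measure $\mu$ on $(\mathbb{Z}^k)^V$ satisfying $\mu\gamma_\Lambda=\mu$ for all finite $\Lambda\subset V$, where $$\gamma_\Lambda(\sigma_\Lambda=\omega_\Lambda\mid\omega)=Z_\Lambda(\omega_{\partial\Lambda})^{-1}\prod_{\{x,y\}\in L,\ \{x,y\}\cap\Lambda\neq\emptyset}Q(\omega_x-\omega_y).$$ Norms: $\Vert x\Vert_{p,S}=\big(\sum_{j\in S}|x(j)|^p\big)^{1/p}$. *)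

(* Defs.v *)
From HB Require Import structures.
From mathcomp Require Import all_boot all_order all_algebra finmap.
From mathcomp Require Import all_classical all_reals all_analysis.

Set Implicit Arguments.
Unset Strict Implicit.
Unset Printing Implicit Defensive.

Import Order.TTheory GRing.Theory Num.Theory.
Import numFieldNormedType.Exports.

Local Open Scope classical_set_scope.
Local Open Scope ring_scope.

(* Vertices form a countType: a connected locally finite graph is countable.
   A cycle of size at most 2 is just a vertex or an edge run back and forth. *)
Record cayley_tree (d : nat) := CayleyTree {
  vertex :> countType ;
  adj : rel vertex ;
  adj_sym : symmetric adj ;
  adj_irr : irreflexive adj ;
  vertex_infinite : infinite_set [set: vertex] ;
  adj_connected : forall x y, exists2 p, path adj x p & last x p = y ;
  adj_acyclic : forall p, uniq p -> cycle adj p -> (size p <= 2)%N ;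
  adj_regular : forall x, ([set y | adj x y] #= `I_d.+1)%card }.

Arguments adj {d} G : rename.

Definition tree_aut d (G : cayley_tree d) (phi : G -> G) : Prop :=
  bijective phi /\ {mono phi : x y / adj G x y}.

HB.instance Definition _ := isPointed.Build int 0.

Notation config G k := (vertex G -> 'rV[int]_k).

Definition cylinders d (G : cayley_tree d) k : set (set (config G k)) :=
  [set A | exists x j, A = [set w : config G k | w x = j]].

(* Since Z^k is countable and discrete, the one-point one-vertex cylinders
   generate the product sigma-algebra. *)
Notation mconfig G k := (g_sigma_algebraType (@cylinders _ G k)).

Section Gibbs.
Context {R : realType} {k d : nat} (G : cayley_tree d).
Variable Q : 'rV[int]_k -> R.

(* The order on pickle codes selects one orientation of every edge {x, y}. *)
Definition edges_meeting (L : {fset G}) : set (G * G) :=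
  [set e : G * G | [/\ adj G e.1 e.2, (choice.pickle e.1 < choice.pickle e.2)%N
             & (e.1 \in L) || (e.2 \in L)]].

Definition boltzmann (L : {fset G}) (w : config G k) : R :=
  \big[*%R/1]_(e \in edges_meeting L) Q (w e.1 - w e.2).

Definition agree_off (L : {fset G}) (w : config G k) : set (config G k) :=
  [set z | forall x, x \notin L -> z x = w x].

Definition partition_function (L : {fset G}) (w : config G k) : \bar R :=
  \esum_(z in agree_off L w) (boltzmann L z)%:E.

(* gamma_L(A | w): a configuration z on L is identified with its extension by w
   off L, so both sums run over agree_off L w.  If Z_L(w) = +oo the kernel is 0
   at w, so a Gibbs measure gives no mass to such w. *)
Definition gibbs_kernel (L : {fset G}) (A : set (config G k)) (w : config G k)
    : \bar R :=
  ((\esum_(z in agree_off L w `&` A) (boltzmann L z)%:E)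
     / partition_function L w)%E.

Definition gibbs_measure (mu : probability (mconfig G k) R) : Prop :=
  forall (L : {fset G}) (A : set (mconfig G k)), measurable A ->
    mu A = (\int[mu]_w gibbs_kernel L A w)%E.

Definition aut_invariant (mu : probability (mconfig G k) R) : Prop :=
  forall phi : G -> G, tree_aut phi ->
  forall A : set (mconfig G k), measurable A ->
    mu [set w : config G k | A (w \o phi)] = mu A.

(* Two measures are compared on measurable sets only. *)
Definition distinct_measures (I : Type) (mu : I -> probability (mconfig G k) R)
    : Prop :=
  forall i j, i <> j -> exists2 A, measurable A & mu i A <> mu j A.

End Gibbs.

Definition lp_norm (R : realType) (T : choiceType) (p : R) (S : set T)
    (x : T -> R) : \bar R :=
  poweR (\esum_(j in S) (powR `|x j| p)%:E) p^-1.

Definition transfer_op (R : realType) k (U : 'rV[int]_k -> R) (beta : R) :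
    'rV[int]_k -> R :=
  fun j => expR (- (beta * U j)).

Definition beta_min (R : realType) (A : R) (d : nat) : R :=
  A * ln d%:R / d.+1%:R.

(* C does not depend on d, beta, the tree, the root or i. *)
Definition localized_from (R : realType) k (U : 'rV[int]_k -> R) (A C : R)
    (n : nat) : Prop :=
  forall d : nat, (n <= d)%N -> forall beta : R, beta_min A d <= beta ->
  forall (G : cayley_tree d) (o : G),
  exists mu : 'rV[int]_k -> probability (mconfig G k) R,
    [/\ distinct_measures mu,
        forall i, aut_invariant (mu i),
        forall i, gibbs_measure (transfer_op U beta) (mu i)
      & forall i, (0 < mu i [set w : config G k | w o = i])%E /\
          (mu i [set w : config G k | w o <> i] / mu i [set w : config G k | w o = i]
             <= (C * (1 / d%:R))%:E)%E].

(* Main.v *)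
(* The measures are tree-indexed Markov chains built from a boundary law.

   Put Q = Q_beta, m = d - 1 and eps = 1 / (8 d).  On the set of u >= 0 with
   u(0) = 1 and sum_(j <> 0) u(j)^m <= eps, the map u |-> N u / N u (0), with
   N u (j) = sum_i Q(j - i) u(i)^d, is a self-map as soon as
   e * sum_(j <> 0) Q(j)^m <= eps / 2, and it halves sup-norm distances.  Its
   fixed point satisfies c u(a) = sum_b Q(a - b) u(b)^d.  Since A v > 1, the sum
   of the Q(j)^m is o(1/d) uniformly in beta >= beta_{A,d}.

   With pi = u^(d+1) / Z, g proportional to 1/u and r(a, b)^2 = Q(a - b), set
   F(L, w) = prod_(x in L) (pi(w_x) prod_(y in L, y ~ x) g(w_x) r(w_x, w_y)).
   The boundary law equation says that summing over the spin of a leaf of a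
   connected L removes the leaf, so the F(L, .) are consistent; nested intervals
   in [0, 1) turn them into a probability on configurations.  The formula is
   symmetric in the vertices, whence automorphism invariance, and pi g^(d+1) is
   constant, whence the DLR equations.  Translating u by i gives mu_i, with
   mu_i(w_o = j) = u(j - i)^(d+1) / Z. *)
Require Import Defs.
From HB Require Import structures.
From mathcomp Require Import all_boot all_order all_algebra finmap.
From mathcomp Require Import all_classical all_reals all_analysis.
From mathcomp Require Import measurable_realfun.
From mathcomp Require Import ring lra zify.
Import Order.TTheory GRing.Theory Num.Theory.
Import numFieldNormedType.Exports.
Local Open Scope classical_set_scope.
Local Open Scope ring_scope.

Set Implicit Arguments.
Unset Strict Implicit.
Unset Printing Implicit Defensive.

(** * Sums of nonnegative families *)

Lemma esumZl (R : realType) (T : choiceType) (I : set T) (c : R)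
    (f : T -> \bar R) : 0 <= c -> (forall i, 0 <= f i)%E ->
  (\esum_(i in I) (c%:E * f i) = c%:E * \esum_(i in I) f i)%E.
Proof.
move=> c0 f0; rewrite /esum -ereal_supZl//; last first.
  apply/set0P; exists 0%E; exists set0 => /=; first exact: fsets_set0.
  by rewrite fsbig_set0.
congr ereal_sup; apply/seteqP; split=> x /=.
  move=> [A AI <-]; exists (\sum_(i \in A) f i)%E; first by exists A.
  by rewrite ge0_mule_fsumr.
by move=> [_ [A AI <-]] <-; exists A => //; rewrite ge0_mule_fsumr.
Qed.

Lemma exchange_esum (R : realType) (T1 T2 : choiceType) (I : set T1)
    (J : set T2) (a : T1 -> T2 -> \bar R) : (forall i j, 0 <= a i j)%E ->
  (\esum_(i in I) \esum_(j in J) a i j = \esum_(j in J) \esum_(i in I) a i j)%E.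
Proof.
move=> a0; rewrite !esum_esum//.
rewrite (reindex_esum (J `*`` fun=> I) _ (fun x => (x.2, x.1)))//; split.
- by move=> [j i] [/= Jj Ii].
- by move=> [j i] [j' i'] _ _ /= [-> ->].
- by move=> [i j] [/= Ii Jj]; exists (j, i).
Qed.

(** Numbers that code no element get the value 0, so a family over a countable type becomes a series
    over the naturals. *)
Definition unpickle_or (R : realType) (T : countType) (f : T -> \bar R)
  (n : nat) : \bar R := oapp f 0%E (pickle_inv n : option T).

Lemma esum_unpickle (R : realType) (T : countType) (f : T -> \bar R) :
  (forall t, 0 <= f t)%E ->
  (\esum_(t in [set: T]) f t = \sum_(n <oo) unpickle_or f n)%E.
Proof.
move=> f0.
have u0 n : (0 <= unpickle_or f n)%E by rewrite /unpickle_or; case: pickle_inv.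
rewrite nneseries_esumT// (esumID (range (@choice.pickle T)))//.
rewrite setTI [X in (_ + X)%E]esum1 ?adde0; last first.
  move=> n [_ /= nr]; rewrite /unpickle_or.
  have := @pickle_invK T n; case: (pickle_inv n) => //= t nt; case: nr.
  by exists t.
rewrite (reindex_esum setT _ (@choice.pickle T)).
  by apply: eq_esum => t _; rewrite /unpickle_or pickleK_inv.
by split => // ? ? _ _; exact: (pcan_inj choice.pickleK).
Qed.

Lemma measure_esum d (M : measurableType d) (R : realType)
    (mu : {measure set M -> \bar R}) (T : countType) (A : T -> set M) :
  (forall t, measurable (A t)) -> trivIset setT A ->
  mu (\bigcup_t A t) = (\esum_(t in [set: T]) mu (A t))%E.
Proof.
move=> mA tA; rewrite esum_unpickle//.
pose B (n : nat) := if (pickle_inv n : option T) is Some t then A t else set0.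
have -> : \bigcup_t A t = \bigcup_n B n.
  apply/seteqP; split=> x [].
    by move=> t _ Atx; exists (choice.pickle t) => //; rewrite /B pickleK_inv.
  by move=> n _; rewrite /B; case: pickle_inv => // t Atx; exists t.
have mB n : measurable (B n) by rewrite /B; case: pickle_inv.
rewrite measure_semi_bigcup//; last 2 first.
- move=> m n _ _; rewrite /B; have := @pickle_invK T m.
  case: (pickle_inv m) => [t /= <-|_]; last by rewrite set0I => -[].
  have := @pickle_invK T n.
  case: (pickle_inv n) => [s /= <-|_]; last by rewrite setI0 => -[].
  by move=> ts; congr choice.pickle; apply: tA.
- exact: bigcup_measurable.
apply: eq_eseriesr => n _; rewrite /B /unpickle_or.
by case: (pickle_inv n) => [t|] //=; rewrite measure0.
Qed.

Lemma esum_ge_term (R : realType) (T : choiceType) (D : set T) (f : T -> \bar R) i :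
  D i -> (f i <= \esum_(j in D) f j)%E.
Proof.
move=> Di; apply: esum_ge; exists [set i]; last by rewrite fsbig_set1.
by split; [exact: finite_set1|move=> _ ->].
Qed.

(** * Existence of a boundary law *)

Section pointwise_banach.
Context {R : realType} {I : Type} (B : (I -> R) -> Prop).
Variables (T : (I -> R) -> I -> R) (f0 : I -> R).
Hypothesis B0 : B f0.
Hypothesis BT : forall f, B f -> B (T f).
Hypothesis Bcvg : forall (f_ : nat -> I -> R) f, (forall n, B (f_ n)) ->
  (forall i, f_ ^~ i @ \oo --> f i) -> B f.
Hypothesis T0 : forall i, `|T f0 i - f0 i| <= 1.
Hypothesis Thalf : forall f g (e : R), B f -> B g ->
  (forall i, `|f i - g i| <= e) -> forall i, `|T f i - T g i| <= e / 2.

Let f_ n := iter n T f0.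

Let Bf_ n : B (f_ n). Proof. by elim: n => [//|n ih]; exact: BT. Qed.

Let step n i : `|f_ n.+1 i - f_ n i| <= 2^-1 ^+ n.
Proof.
elim: n i => [|n ih] i; first exact: T0.
by rewrite exprS mulrC; exact: Thalf (Bf_ _) (Bf_ _) ih i.
Qed.

(** Subtracting the part of the geometric series still to come makes the bound inductive in [k]. *)
Let tail n k i : `|f_ (n + k)%N i - f_ n i| <= 2 * 2^-1 ^+ n - 2 * 2^-1 ^+ (n + k).
Proof.
elim: k => [|k ih]; first by rewrite addn0 !subrr normr0.
rewrite addnS -(subrKA (f_ (n + k)%N i)) (le_trans (ler_normD _ _))//.
have := step (n + k) i; rewrite exprS; move: ih; lra.
Qed.

(** Picard iteration from [f0]: consecutive iterates differ by at most 2^-n at every index, so each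
    coordinate converges geometrically. The limit is taken pointwise, which is why [Bcvg] asks for
    closure under pointwise convergence. *)
Lemma pointwise_banach : exists2 f, B f & forall i, T f i = f i.
Proof.
have half_lt1 : `|2^-1 : R| < 1 by rewrite ger0_norm ?invr_ge0// invf_lt1 ?ltr1n.
have cf i : cvgn (f_ ^~ i).
  have -> : f_ ^~ i = (fun n => f_ 0%N i + series (telescope (f_ ^~ i)) n).
    by apply/funext => n; rewrite -eq_sum_telescope.
  apply: is_cvgD; first exact: is_cvg_cst.
  apply: normed_cvg; apply: (@series_le_cvg _ _ (geometric 1 2^-1)) => //.
  - by move=> n /=; exact: normr_ge0.
  - by move=> n; rewrite /geometric/= mulr_ge0 ?exprn_ge0 ?invr_ge0.
  - by move=> n; rewrite /geometric/= mul1r; exact: step.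
  - exact: is_cvg_geometric_series.
pose f i := limn (f_ ^~ i).
have fT n i : `|f i - f_ n i| <= 2 * 2^-1 ^+ n.
  have c : `|f_ m i - f_ n i| @[m --> \oo] --> `|f i - f_ n i|.
    by apply: cvg_norm; apply: cvgB; [exact: cf|exact: cvg_cst].
  apply: (cvgr_to_le c); exists n => // m /= nm.
  rewrite -(subnKC nm) (le_trans (tail _ _ _))// gerBl mulr_ge0//.
have Bf : B f by apply: (Bcvg Bf_) => i; exact: cf.
exists f => // i; apply/eqP; rewrite -subr_eq0 -normr_le0.
have c : (4 : R) * 2^-1 ^+ n @[n --> \oo] --> 0.
  by rewrite -(mulr0 4); apply: cvgMr; exact: cvg_expr.
apply: (cvgr_to_ge c); exists 0%N => // n _ /=.
rewrite -(subrKA (f_ n.+1 i)) (le_trans (ler_normD _ _))//.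
have h1 := Thalf Bf (Bf_ n) (fT n) i; have := fT n.+1 i.
rewrite distrC exprS; move: h1; rewrite /f_ /=.
have : 0 <= (2^-1 : R) ^+ n by rewrite exprn_ge0// invr_ge0.
by move: (2^-1 ^+ n) => x; lra.
Qed.

End pointwise_banach.

(* The tangent line at a of the convex function q |-> q ^ (m + 1). *)
Lemma pow_tangent (R : realType) (a q : R) (m : nat) : 0 <= a -> 0 <= q ->
  m.+1%:R * a ^+ m * q <= q ^+ m.+1 + m%:R * a ^+ m.+1.
Proof.
move=> a0 q0; elim: m => [|m ih]; first by rewrite !expr0 expr1; lra.
have := ler_wpM2l q0 ih.
(* Added to [q] times the induction hypothesis, this square gives the next tangent inequality. *)
have : 0 <= m.+1%:R * a ^+ m * (q - a) ^+ 2.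
  by rewrite mulr_ge0 ?sqr_ge0// mulr_ge0 ?exprn_ge0.
rewrite -(natr1 m.+1) -(natr1 m) !exprS !expr0 !mulr1.
move: (a ^+ m) (q ^+ m) (m%:R) => x y z; lra.
Qed.

(** For x > y the tangent at x bounds the increase of the power by (m + 1) x^m (x - y); for x <= y
    monotonicity suffices. *)
Lemma pow_le_add (R : realType) (x y e : R) (m : nat) : 0 <= x -> 0 <= y ->
  `|x - y| <= e -> x ^+ m.+1 <= y ^+ m.+1 + m.+1%:R * e * (x ^+ m + y ^+ m).
Proof.
move=> x0 y0 xye.
have e0 : 0 <= e by apply: le_trans xye.
have [xy|yx] := leP x y.
  apply: (@le_trans _ _ (y ^+ m.+1)); first by rewrite lerXn2r ?nnegrE.
  by rewrite lerDl !mulr_ge0 ?addr_ge0 ?exprn_ge0.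
have xye' : x - y <= e by rewrite (le_trans (ler_norm _)).
have xm0 : 0 <= m.+1%:R * x ^+ m by rewrite mulr_ge0 ?exprn_ge0.
have ym0 : 0 <= m.+1%:R * y ^+ m * e by rewrite !mulr_ge0 ?exprn_ge0.
have := ler_wpM2l xm0 xye'; have := pow_tangent m x0 y0.
move: xm0 ym0; rewrite -(natr1 m) (exprS x).
move: (x ^+ m) (y ^+ m) (y ^+ m.+1) (m%:R) => p q r z; lra.
Qed.

(** Two regimes. If m y <= q, then q + y <= (1 + 1/m) q and (1 + 1/m)^m <= e; otherwise q < m y and
    q + y <= (m + 1) y. *)
Lemma pow_add_le (R : realType) (q y : R) (m : nat) : 0 <= q -> 0 <= y ->
  (q + y) ^+ m <= expR 1 * q ^+ m + (m.+1%:R * y) ^+ m.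
Proof.
move=> q0 y0; have [myq|qmy] := leP (m%:R * y) q.
  apply: (@le_trans _ _ (expR 1 * q ^+ m)); last first.
    by rewrite lerDl exprn_ge0 ?mulr_ge0.
  case: m myq => [|m] myq.
    by rewrite !expr0 mulr1; have := expR_ge1Dx (1 : R); lra.
  have -> : expR 1 = expR (m.+1%:R^-1) ^+ m.+1 :> R.
    by rewrite -expRM_natl mulfV ?pnatr_eq0.
  rewrite -exprMn lerXn2r ?nnegrE ?addr_ge0 ?mulr_ge0 ?expR_ge0//.
  apply: (@le_trans _ _ ((1 + m.+1%:R^-1) * q)); last first.
    by rewrite ler_wpM2r ?expR_ge1Dx.
  by rewrite mulrDl mul1r lerD2l mulrC ler_pdivlMr ?ltr0n// mulrC.
apply: (@le_trans _ _ ((m.+1%:R * y) ^+ m)); last first.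
  by rewrite lerDr mulr_ge0 ?exprn_ge0 ?expR_ge0.
rewrite lerXn2r ?nnegrE ?addr_ge0 ?mulr_ge0//.
by rewrite -natr1 mulrDl mul1r lerD2r ltW.
Qed.

(* Jensen's inequality for the weights x i / e, from the tangent line at y / e. *)
Lemma esum_pow_le (R : realType) (V : choiceType) (D : set V) (q x : V -> R)
    (e y : R) (m : nat) :
  (forall i, 0 <= q i) -> (forall i, 0 <= x i) -> 0 < e -> 0 <= y ->
  (\esum_(i in D) (x i)%:E <= e%:E)%E ->
  (\esum_(i in D) (q i * x i)%:E = y%:E)%E ->
  ((y ^+ m.+1)%:E <= (e ^+ m)%:E * \esum_(i in D) (q i ^+ m.+1 * x i)%:E)%E.
Proof.
move=> q0 x0 e0 y0 xe qxy.
set E := (\esum_(i in D) (q i ^+ m.+1 * x i)%:E)%E.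
pose a := y / e; have a0 : 0 <= a by rewrite divr_ge0// ltW.
have am0 k : 0 <= a ^+ k by rewrite exprn_ge0.
have : (\esum_(i in D) ((m.+1%:R * a ^+ m)%:E * (q i * x i)%:E)
    <= \esum_(i in D) ((q i ^+ m.+1 * x i)%:E + (m%:R * a ^+ m.+1)%:E * (x i)%:E))%E.
  apply: le_esum => i _; rewrite -!EFinM -EFinD lee_fin.
  have := ler_wpM2r (x0 i) (pow_tangent m a0 (q0 i)); lra.
rewrite esumZl ?mulr_ge0//; last by move=> i; rewrite lee_fin mulr_ge0.
rewrite qxy esumD//; last 2 first.
- by move=> i _; rewrite lee_fin mulr_ge0 ?exprn_ge0.
- by move=> i _; rewrite -EFinM lee_fin !mulr_ge0.
rewrite esumZl ?mulr_ge0//.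
have E0 : (0 <= E)%E.
  by apply: esum_ge0 => i _; rewrite lee_fin mulr_ge0 ?exprn_ge0.
rewrite -/E; move: E E0 => [E| |] E0 //; last first.
  by move=> _; rewrite mulry gtr0_sg ?exprn_gt0// mul1e leey.
move=> h.
have : ((m.+1%:R * a ^+ m)%:E * y%:E <= E%:E + (m%:R * a ^+ m.+1)%:E * e%:E)%E.
  rewrite (le_trans h)// leeD2l// lee_wpmul2l// lee_fin mulr_ge0//.
rewrite -!EFinM -EFinD !lee_fin.
have ye : y = a * e by rewrite /a mulfVK ?gt_eqF.
rewrite ye -(natr1 m) => h1.
have h2 : a ^+ m.+1 * e <= E by move: h1; rewrite exprS; move: (a ^+ m) (m%:R) => z w; lra.
rewrite exprMn (exprS e).
have := ler_wpM2l (exprn_ge0 m (ltW e0)) h2; move: (a ^+ m.+1) (e ^+ m) => z w; lra.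
Qed.

Lemma esum_finE (R : realType) (T : choiceType) (D : set T) (f : T -> R) (c : R) :
  (forall i, D i -> 0 <= f i) -> (\esum_(i in D) (f i)%:E <= c%:E)%E ->
  (\esum_(i in D) (f i)%:E = (fine (\esum_(i in D) (f i)%:E))%:E)%E.
Proof.
move=> f0 fc; rewrite fineK// ge0_fin_numE ?(le_lt_trans fc) ?ltry//.
exact: esum_ge0.
Qed.

(** * The normalised boundary law operator and its fixed point *)

Section boundary_law.
Context {R : realType} {V : zmodType} (Q : V -> R) (m : nat) (eta : R).
Hypothesis Q_gt0 : forall j, 0 < Q j.
Hypothesis Q_le1 : forall j, Q j <= 1.
Hypothesis Q_0 : Q 0 = 1.
Hypothesis m_ge3 : (3 <= m)%N.

(** With m = d - 1, the exponents [m.+1] and [m.+2] below are d and d + 1. *)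
Let eps : R := (8 * m.+1%:R)^-1.
Let D : set V := [set j | j <> 0].

Hypothesis Q_eta : (\esum_(j in D) (Q j ^+ m)%:E <= eta%:E)%E.
Hypothesis eta_le : expR 1 * eta <= eps / 2.

Let law (u : V -> R) : Prop :=
  [/\ u 0 = 1, forall j, 0 <= u j & (\esum_(j in D) (u j ^+ m)%:E <= eps%:E)%E].

Let eps_gt0 : 0 < eps. Proof. by rewrite invr_gt0 mulr_gt0. Qed.

Let epsE : m.+1%:R * eps = 8^-1.
Proof. by rewrite /eps invfM mulrCA mulfV ?mulr1// pnatr_eq0. Qed.

Let eps_le1 : eps <= 8^-1.
Proof. by rewrite -epsE ler_peMl ?ler1n// ltW. Qed.

Let Q_ge0 j : 0 <= Q j. Proof. exact: ltW. Qed.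

Let law_le1 u j : law u -> u j <= 1.
Proof.
move=> [u0 up ue]; have [->|/eqP j0] := eqVneq j 0; first by rewrite u0.
have m0 : (0 < m)%N by apply: leq_trans m_ge3.
rewrite -(expr_le1 m0 (up j)) -lee_fin.
have /= := @esum_ge_term _ _ D (fun j => (u j ^+ m)%:E) j j0.
move=> /le_trans; apply; rewrite (le_trans ue)// lee_fin (le_trans eps_le1)//.
lra.
Qed.

Let law_sum u : law u -> (\esum_(j in D) (u j ^+ m.+1)%:E <= eps%:E)%E.
Proof.
move=> lu; have [u0 up ue] := lu; apply: le_trans ue; apply: le_esum => j _.
by rewrite lee_fin exprS ler_piMl ?exprn_ge0// law_le1.
Qed.

(** The contribution of the spins i <> 0 to N u (j). On a law [fine] loses nothing, since the sum is
    at most [eps] by [Y_bnd]. *)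
Let Y (u : V -> R) (j : V) : R :=
  fine (\esum_(i in D) (Q (j - i) * u i ^+ m.+1)%:E)%E.

Let Y_bnd u j : law u ->
  (\esum_(i in D) (Q (j - i) * u i ^+ m.+1)%:E <= eps%:E)%E.
Proof.
move=> lu; have [u0 up ue] := lu; apply: le_trans (law_sum lu).
by apply: le_esum => i _; rewrite lee_fin ler_piMl ?exprn_ge0.
Qed.

Let YE u j : law u ->
  (\esum_(i in D) (Q (j - i) * u i ^+ m.+1)%:E = (Y u j)%:E)%E.
Proof.
move=> lu; have [u0 up ue] := lu; apply: esum_finE (Y_bnd j lu) => i _.
by rewrite mulr_ge0 ?exprn_ge0.
Qed.

Let Y_ge0 u j : law u -> 0 <= Y u j.
Proof.
move=> lu; have [u0 up ue] := lu; rewrite -lee_fin -YE//.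
by apply: esum_ge0 => i _; rewrite lee_fin mulr_ge0 ?exprn_ge0.
Qed.

Let N u j := Q j + Y u j.

Let NE u j : law u ->
  (\esum_(i in setT) (Q (j - i) * u i ^+ m.+1)%:E = (N u j)%:E)%E.
Proof.
move=> lu; have [u0 up ue] := lu.
rewrite (esumID D); last by move=> i _; rewrite lee_fin mulr_ge0 ?exprn_ge0.
rewrite !setTI YE//.
have -> : ~` D = [set 0] by apply/seteqP; split=> x /=; [move/contrapT|move=> -> []].
rewrite esum_set1; last by rewrite lee_fin mulr_ge0 ?exprn_ge0.
by rewrite subr0 u0 expr1n mulr1 addrC.
Qed.

Let N_ge1 u : law u -> 1 <= N u 0.
Proof. by move=> lu; rewrite /N Q_0 lerDl Y_ge0. Qed.

Let T u j := N u j / N u 0.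

Let eta_ge0 : 0 <= eta.
Proof.
by rewrite -lee_fin; apply: le_trans Q_eta; apply: esum_ge0 => j _; rewrite lee_fin exprn_ge0.
Qed.

Let eta_le1 : eta <= 1.
Proof.
have : eta <= expR 1 * eta.
  by rewrite ler_peMl//; have := expR_ge1Dx (1 : R); lra.
by have := eps_le1; move: eta_le; lra.
Qed.

Let sum_Qm i : (\esum_(j in setT) (Q (j - i) ^+ m)%:E <= 2%:E)%E.
Proof.
rewrite -(@reindex_esum R V V setT setT (fun j => j - i)
  (fun j => (Q j ^+ m)%:E))//; last first.
  split=> //; first by move=> x y _ _ /addIr.
  by move=> x _; exists (x + i); rewrite ?addrK.
rewrite (esumID D); last by move=> j _; rewrite lee_fin exprn_ge0.
rewrite !setTI.
have -> : ~` D = [set 0] by apply/seteqP; split=> x /=; [move/contrapT|move=> -> []].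
rewrite esum_set1 ?lee_fin ?exprn_ge0// Q_0 expr1n.
by rewrite (@le_trans _ _ (eta%:E + 1%:E)%E) ?leeD2r// -EFinD lee_fin; move: eta_le1; lra.
Qed.

(** Jensen moves the power m from the convolution onto Q, at the price eps^(m-1). After exchanging
    the sums, the inner sum of Q(j - i)^m over j is at most 2 and the outer one of u(i)^(m+1) at
    most eps. *)
Let sum_Ym u : law u ->
  (\esum_(j in D) (Y u j ^+ m)%:E <= (2 * eps ^+ m)%:E)%E.
Proof.
move=> lu; have [u0 up ue] := lu.
have mE : m.-1.+1 = m by rewrite prednK// (leq_trans _ m_ge3).
apply: (@le_trans _ _ (\esum_(j in D) ((eps ^+ m.-1)%:E *
    \esum_(i in D) (Q (j - i) ^+ m * u i ^+ m.+1)%:E)))%E.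
  apply: le_esum => j _.
  have := @esum_pow_le R V D (fun i => Q (j - i)) (fun i => u i ^+ m.+1)
    eps (Y u j) m.-1; rewrite mE; apply => //; first by move=> i; rewrite exprn_ge0.
  - exact: Y_ge0.
  - exact: law_sum.
  - exact: YE.
have ge0 i j : (0 <= (Q (j - i) ^+ m * u i ^+ m.+1)%:E)%E.
  by rewrite lee_fin mulr_ge0 ?exprn_ge0.
have em k : 0 <= eps ^+ k by rewrite exprn_ge0 ?ltW.
rewrite esumZl//; last by move=> j; exact: esum_ge0.
rewrite exchange_esum//.
have -> : 2 * eps ^+ m = eps ^+ m.-1 * (2 * eps) by rewrite -{1}mE exprSr; ring.
rewrite [X in (_ <= X)%E]EFinM lee_wpmul2l ?lee_fin//.
rewrite [X in (_ <= X)%E]EFinM.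
apply: (@le_trans _ _ (2%:E * \esum_(i in D) (u i ^+ m.+1)%:E))%E; last first.
  by rewrite lee_wpmul2l// law_sum.
rewrite -esumZl//; last by move=> i; rewrite lee_fin exprn_ge0.
apply: le_esum => i _.
apply: (@le_trans _ _ ((u i ^+ m.+1)%:E * \esum_(j in D) (Q (j - i) ^+ m)%:E))%E.
  rewrite -esumZl ?exprn_ge0//; last by move=> j; rewrite lee_fin exprn_ge0.
  by apply: le_esum => j _; rewrite -EFinM mulrC.
rewrite muleC lee_wpmul2r ?lee_fin ?exprn_ge0//.
apply: le_trans (sum_Qm i); rewrite esum_mkcond; apply: le_esum => j _.
by case: ifP => // _; rewrite lee_fin exprn_ge0.
Qed.

(** Since (m + 1) eps = 1/8, the claim reads 32 (m + 1) <= 8^m, which holds from m = 3 on and fails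
    at m = 2. *)
Let contraction_small : (m.+1%:R * eps) ^+ m * 2 <= eps / 2.
Proof.
rewrite epsE exprVn ler_pdivrMl ?exprn_gt0//.
have m10 : (0 : R) < 16 * m.+1%:R by rewrite mulr_gt0 ?ltr0n.
have -> : eps / 2 = (16 * m.+1%:R)^-1 by rewrite /eps -invfM; congr (_^-1); ring.
rewrite ler_pdivlMr//.
suff : (32 * m.+1 <= 8 ^ m)%N.
  rewrite -(ler_nat R) natrM natrX; move: m10.
  move: (m.+1%:R : R) ((8%:R : R) ^+ m) => x y; lra.
have -> : m = (m - 3 + 3)%N by rewrite subnK.
by elim: (m - 3)%N => [//|k ih]; rewrite addSn expnS; move: ih; lia.
Qed.

(** Dividing by N u (0) >= 1 only helps. By [pow_add_le] the Q part costs at most e * eta <= eps /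
    2, and the Y part at most (m + 1)^m * 2 eps^m, which is again at most eps / 2. *)
Let law_T u : law u -> law (T u).
Proof.
move=> lu; have [u0 up ue] := lu.
have N0 : 0 < N u 0 by rewrite (lt_le_trans ltr01) ?N_ge1.
have Np j : 0 <= N u j by rewrite addr_ge0 ?Y_ge0.
split; first by rewrite /T mulfV ?gt_eqF.
  by move=> j; rewrite divr_ge0 ?(ltW N0).
apply: (@le_trans _ _ (\esum_(j in D) ((expR 1)%:E * (Q j ^+ m)%:E
   + (m.+1%:R ^+ m)%:E * (Y u j ^+ m)%:E)))%E.
  apply: le_esum => j _; rewrite -!EFinM -EFinD lee_fin.
  rewrite -exprMn; apply: le_trans (pow_add_le _ _ _); rewrite ?Y_ge0//.
  rewrite lerXn2r ?nnegrE ?divr_ge0 ?addr_ge0 ?Y_ge0 ?(ltW N0)//.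
  by rewrite ler_pdivrMr// ler_peMr ?N_ge1.
rewrite esumD; last 2 first.
- by move=> j _; rewrite -EFinM lee_fin mulr_ge0 ?expR_ge0 ?exprn_ge0.
- by move=> j _; rewrite -EFinM lee_fin mulr_ge0 ?exprn_ge0 ?Y_ge0.
rewrite !esumZl ?expR_ge0 ?exprn_ge0//; last 2 first.
- by move=> j; rewrite lee_fin exprn_ge0 ?Y_ge0.
- by move=> j; rewrite lee_fin exprn_ge0.
apply: (@le_trans _ _ ((expR 1)%:E * eta%:E
    + (m.+1%:R ^+ m)%:E * (2 * eps ^+ m)%:E)%E).
  by rewrite leeD// lee_wpmul2l ?lee_fin ?expR_ge0 ?exprn_ge0 ?sum_Ym.
rewrite -!EFinM -EFinD lee_fin.
have := contraction_small; rewrite exprMn; move: eta_le.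
move: (expR 1) (m.+1%:R ^+ m) (eps ^+ m) => x y z; lra.
Qed.

(** The linearised difference of the powers sums to at most (m + 1) e (eps + eps), which is e / 4
    because (m + 1) eps = 1/8. *)
Let Y_le u w e j : law u -> law w -> (forall i, `|u i - w i| <= e) ->
  Y u j <= Y w j + e / 4.
Proof.
move=> lu lw uwe; have [u0 up ue] := lu; have [w0 wp we] := lw.
have e0 : 0 <= e by apply: le_trans (uwe 0).
have me0 : 0 <= m.+1%:R * e by rewrite mulr_ge0.
rewrite -lee_fin EFinD -!YE//.
apply: (@le_trans _ _ (\esum_(i in D) ((Q (j - i) * w i ^+ m.+1)%:E
   + (m.+1%:R * e)%:E * ((u i ^+ m)%:E + (w i ^+ m)%:E))))%E.
  apply: le_esum => i _; rewrite -!(EFinD, EFinM) lee_fin.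
  have h := pow_le_add m (up i) (wp i) (uwe i).
  apply: (le_trans (ler_wpM2l (Q_ge0 _) h)); rewrite mulrDr lerD2l ler_piMl//.
  by rewrite mulr_ge0 ?addr_ge0 ?exprn_ge0.
rewrite esumD; last 2 first.
- by move=> i _; rewrite lee_fin mulr_ge0 ?exprn_ge0.
- by move=> i _; rewrite mule_ge0 ?lee_fin ?addr_ge0 ?exprn_ge0.
rewrite leeD2l// esumZl//; last by move=> i; rewrite -EFinD lee_fin addr_ge0 ?exprn_ge0.
rewrite esumD; last 2 first.
- by move=> i _; rewrite lee_fin exprn_ge0.
- by move=> i _; rewrite lee_fin exprn_ge0.
apply: (@le_trans _ _ ((m.+1%:R * e)%:E * (eps%:E + eps%:E)))%E.
  by rewrite lee_wpmul2l ?lee_fin// leeD.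
rewrite -EFinD -EFinM lee_fin; have := epsE; move: (m.+1%:R : R) eps => x y xy.
have -> : x * e * (y + y) = 2 * e * (x * y) by ring.
by rewrite xy; lra.
Qed.

(** Numerator and denominator each move by at most e / 4; as T w (j) <= 1 and N u (0) >= 1, the
    quotient moves by at most the sum of the two. The reverse inequality follows by exchanging u and
    w. *)
Let T_le u w e j : law u -> law w -> (forall i, `|u i - w i| <= e) ->
  T u j - T w j <= e / 2.
Proof.
move=> lu lw uwe.
have e0 : 0 <= e by apply: le_trans (uwe 0).
have wue i : `|w i - u i| <= e by rewrite distrC.
have Tw1 := law_le1 j (law_T lw); have [_ /(_ j) Tw0 _] := law_T lw.
have Nj : N u j <= N w j + e / 4 by rewrite /N -addrA lerD2l Y_le.
have N0 : N w 0 <= N u 0 + e / 4 by rewrite /N -addrA lerD2l Y_le.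
have Nu := N_ge1 lu; have Nw := N_ge1 lw.
have Nu0 : 0 < N u 0 by rewrite (lt_le_trans ltr01).
have Nw0 : 0 < N w 0 by rewrite (lt_le_trans ltr01).
have NwE : N w j = T w j * N w 0 by rewrite /T mulfVK ?gt_eqF.
rewrite lerBlDr {1}/T ler_pdivrMr// (le_trans Nj)// NwE.
have h1 := ler_wpM2l Tw0 N0.
have h2 : T w j * (e / 4) <= e / 4 by rewrite ler_piMl//; lra.
have h3 : e / 2 <= e / 2 * N u 0 by rewrite ler_peMr//; lra.
move: h1 h2 h3; move: (T w j) (N w 0) (N u 0) => x y z; lra.
Qed.

(** Every finite partial sum passes to the limit with its bound, and the infinite sum is the
    supremum of these. *)
Let law_cvg (u_ : nat -> V -> R) u : (forall n, law (u_ n)) ->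
  (forall i, u_ ^~ i @ \oo --> u i) -> law u.
Proof.
move=> lu cu.
have up j : 0 <= u j.
  by apply: (cvgr_to_ge (cu j)); exists 0%N => // n _; have [_ + _] := lu n; exact.
split=> //.
  have /cvg_lim <- // := cu 0; apply/cvg_lim => //.
  have -> : u_ ^~ 0 = cst 1 by apply/funext => n; have [] := lu n.
  exact: cvg_cst.
apply: ge_ereal_sup => _ /= [F [finF FD] <-].
rewrite fsbig_finite//= sumEFin lee_fin.
have c : \sum_(i <- fset_set F) u_ n i ^+ m @[n --> \oo]
    --> \sum_(i <- fset_set F) u i ^+ m.
  elim: (enum_fset _) => [|i s ih].
    by under eq_fun do rewrite big_nil; rewrite big_nil; exact: cvg_cst.
  under eq_fun do rewrite big_cons; rewrite big_cons; apply: cvgD ih.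
  apply: (@continuous_cvg _ _ _ _ _ (u_ ^~ i) (fun x : R => x ^+ m)); last exact: cu.
  exact: exprn_continuous.
apply: (cvgr_to_le c); exists 0%N => // n _; have [_ _ une] := lu n.
rewrite -lee_fin; apply: le_trans une.
apply: esum_ge; exists F => //; rewrite fsbig_finite//= sumEFin//.
Qed.

Lemma boundary_law_exists : exists (u : V -> R) (c : R),
  [/\ u 0 = 1, forall j, 0 < u j, 0 < c,
      (\esum_(j in D) (u j ^+ m.+2)%:E <= ((8 * m.+1%:R)^-1)%:E)%E
    & forall a, (\esum_(b in setT) (Q (a - b) * u b ^+ m.+1)%:E
                 = (c * u a)%:E)%E].
Proof.
(* The iteration starts from the indicator of 0, whose sum off 0 vanishes. *)
pose u0 (j : V) : R := (j == 0)%:R.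
have l0 : law u0.
  split; rewrite /u0 ?eqxx//.
  rewrite esum1 ?lee_fin ?ltW// => j /eqP /negPf ->.
  by rewrite expr0n; case: (m) m_ge3.
have [//|||||u lu Tu] := @pointwise_banach R V law T u0.
- exact: law_T.
- exact: law_cvg.
- move=> j; rewrite ler_norml.
  have h1 := law_le1 j (law_T l0); have [_ /(_ j) h2 _] := law_T l0.
  have h3 : 0 <= u0 j by rewrite /u0.
  have h4 : u0 j <= 1 by rewrite /u0; case: eqP.
  by apply/andP; split; lra.
- move=> f g e lf lg fge j; rewrite ler_norml lerNl opprB T_le//= ?T_le// => i.
  by rewrite distrC.
have N0 : 0 < N u 0 by rewrite (lt_le_trans ltr01) ?N_ge1.
(* Laws are only nonnegative; strict positivity of the fixed point is inherited from Q through N u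
   (j) >= Q j. The constant c is N u (0). *)
have Np j : 0 < N u j by rewrite ltr_wpDr ?Y_ge0.
have up j : 0 < u j by rewrite -Tu divr_gt0.
exists u, (N u 0); have [u_0 _ ue] := lu; split=> //.
- apply: le_trans (law_sum lu); apply: le_esum => j _.
  by rewrite lee_fin (exprS _ m.+1) ler_piMl ?exprn_ge0 ?law_le1 ?ltW.
- by move=> a; rewrite NE//; congr EFin; rewrite -Tu mulrC mulfVK ?gt_eqF.
Qed.

End boundary_law.

(** * Finite connected subsets of the tree *)

Definition fconnected d (G : cayley_tree d) (L : {fset G}) : Prop :=
  forall x y, x \in L -> y \in L ->
  exists p, [/\ path (adj G) x p, last x p = y & {subset p <= L}].

Section tree.
Context {d : nat} (G : cayley_tree d).
Implicit Types (L M : {fset G}) (x y : G).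

(** A simple path from x to x' inside L closes up through y to a cycle; acyclicity leaves room for
    at most two vertices, so the path is trivial. *)
Lemma fconnected_neighbour_uniq L x x' y : fconnected L -> y \notin L ->
  x \in L -> x' \in L -> adj G y x -> adj G y x' -> x = x'.
Proof.
move=> cL yL xL x'L yx yx'; have [p [xp px' pL]] := cL _ _ xL x'L.
case/shortenP: xp px' => p' xp' up' sp' px'.
have : (size (y :: x :: p') <= 2)%N.
  apply: (@adj_acyclic _ G).
    rewrite cons_uniq up' andbT inE negb_or; apply/andP; split.
      by apply: contraNneq yL => ->.
    by apply: contra yL => /sp' /pL.
  by rewrite /= rcons_path yx xp' px' adj_sym.
by case: p' px' {xp' up' sp'}.
Qed.

Lemma path_exit (P : pred G) x p : path (adj G) x p -> P x -> ~~ P (last x p) ->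
  exists a b, [/\ P a, ~~ P b, b \in p & adj G a b].
Proof.
elim: p x => [x _ /= ->//|z p ih x /= /andP[xz zp] Px Pl].
have [Pz|Pz] := boolP (P z); last by exists x, z; rewrite mem_head.
by have [a [b [Pa Pb bp ab]]] := ih z zp Pz Pl; exists a, b; rewrite inE bp orbT.
Qed.

Lemma fconnected_extend L x y : fconnected L -> x \in L -> adj G x y ->
  fconnected (y |` L)%fset.
Proof.
move=> cL xL xy a b; rewrite !inE => /orP[/eqP->|aL] /orP[/eqP->|bL].
- by exists [::].
- have [p [xp pb pL]] := cL _ _ xL bL; exists (x :: p); split => //=.
    by rewrite adj_sym xy.
  by move=> z; rewrite !inE => /predU1P[->|/pL ->]; rewrite ?xL orbT.
- have [p [ap px pL]] := cL _ _ aL xL; exists (rcons p y); split => //=.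
  + by rewrite rcons_path ap px.
  + by rewrite last_rcons.
  + by move=> z; rewrite mem_rcons !inE => /predU1P[->|/pL ->]; rewrite ?eqxx ?orbT.
- have [p [ap pb pL]] := cL _ _ aL bL; exists p; split => // z /pL zL.
  by rewrite inE zL orbT.
Qed.

Lemma fconnected1 x : fconnected [fset x]%fset.
Proof. by move=> a b; rewrite !inE => /eqP-> /eqP->; exists [::]. Qed.

Lemma fset_notin L : exists x, x \notin L.
Proof.
apply: contrapT => h; apply: (@vertex_infinite _ G).
apply: (@sub_finite_set _ _ [set` L]); last exact: finite_fset.
by move=> x _ /=; apply: contrapT => /negP xL; apply: h; exists x.
Qed.

Lemma boundary_exists L x : x \in L ->
  exists a b, [/\ a \in L, b \notin L & adj G a b].
Proof.
move=> xL; have [z zL] := fset_notin L.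
have [p xp pz] := @adj_connected _ G x z.
have [] := @path_exit (mem L) x p xp xL; first by rewrite pz.
by move=> a [b [aL bL _ ab]]; exists a, b.
Qed.

Lemma fconnected_grow L M x : fconnected M -> {subset L <= M} -> x \in L ->
  ~ {subset M <= L} -> exists a b, [/\ a \in L, b \in M, b \notin L & adj G a b].
Proof.
move=> cM LM xL ML; have [z zM zL] : exists2 z, z \in M & z \notin L.
  apply: contrapT => h; apply: ML => z zM; apply: contrapT => /negP zL.
  by apply: h; exists z.
have [p [xp pz pM]] := cM x z (LM _ xL) zM.
have [] := @path_exit (mem L) x p xp xL; first by rewrite pz.
by move=> a [b [aL bL bp ab]]; exists a, b; split => //; exact: pM.
Qed.

(** * An enumeration of the vertices with connected initial segments *)

Section enumeration.
Variable o : G.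

(** The vertices that may be added next: the root to the empty set, otherwise an outer neighbour.
    Always adding the one with the least code ensures that no vertex is postponed for ever. *)
Let candidate L y : Prop := y \notin L /\
  (L = fset0 /\ y = o \/ exists2 x, x \in L & adj G x y).

Let candidateP L : exists n, `[< exists2 y, candidate L y & choice.pickle y = n >].
Proof.
have [->|[x xL]] := fset_0Vmem L.
  exists (choice.pickle o); apply/asboolP; exists o => //.
  by split; [rewrite inE|left].
have [a [b [aL bL ab]]] := boundary_exists xL.
exists (choice.pickle b); apply/asboolP; exists b => //; split=> //.
by right; exists a.
Qed.

Let next_spec L : exists y, candidate L y /\
  forall z, candidate L z -> (choice.pickle y <= choice.pickle z)%N.
Proof.
case: (ex_minnP (candidateP L)) => n /asboolP[y cy yn] nmin.
by exists y; split => // z cz; rewrite yn; apply: nmin; apply/asboolP; exists z.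
Qed.

Let next L := projT1 (cid (next_spec L)).

Let hull (n : nat) : {fset G} := iter n (fun L => next L |` L)%fset fset0.

Let v n := next (hull n).

Let vP n : candidate (hull n) (v n).
Proof. by have [] := projT2 (cid (next_spec (hull n))). Qed.

Let v_min n z : candidate (hull n) z -> (choice.pickle (v n) <= choice.pickle z)%N.
Proof. by have [_] := projT2 (cid (next_spec (hull n))); exact. Qed.

Let hull_sub n k : {subset hull n <= hull (n + k)}.
Proof.
move=> x xn; elim: k => [|k ih]; first by rewrite addn0.
by rewrite addnS /hull iterS in_fset1U ih orbT.
Qed.

Let v_hull n k : (n < k)%N -> v n \in hull k.
Proof.
by move=> /subnKC <-; apply: hull_sub; rewrite /hull iterS in_fset1U eqxx.
Qed.

Let v_inj : injective v.
Proof.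
suff lt_neq i j : (i < j)%N -> v i <> v j.
  by move=> i j vij; case: (ltngtP i j) => // /lt_neq; rewrite vij.
by move=> /v_hull vij; have [+ _] := vP j => /[swap] <-; rewrite vij.
Qed.

(* Otherwise y stays a candidate from step n on, and the infinitely many vertices
   chosen afterwards all have codes at most that of y. *)
Let hull_adj n x y : x \in hull n -> adj G x y -> exists m, y \in hull m.
Proof.
move=> xn xy; apply: contrapT => h.
have hm m : y \notin hull m by apply/negP => ym; apply: h; exists m.
have vle k : (choice.pickle (v (n + k)) < (choice.pickle y).+1)%N.
  rewrite ltnS; apply: v_min; split=> //; right; exists x => //.
  exact: hull_sub.
pose f (i : 'I_(choice.pickle y).+2) : 'I_(choice.pickle y).+1 := Ordinal (vle i).
have /leq_card : injective f.
  by move=> i j [] /(pcan_inj choice.pickleK) /v_inj /addnI /val_inj.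
by rewrite !card_ord ltnn.
Qed.

Let hull_all y : exists n, y \in hull n.
Proof.
have v0 : v 0 = o by have [_ [[]|[x]]] := vP 0.
have [p op <-] := @adj_connected _ G o y.
elim/last_ind: p op => [|p z ih]; first by exists 1%N; have := @v_hull 0 1 isT; rewrite v0.
rewrite rcons_path last_rcons => /andP[/ih[n pn] pz].
exact: hull_adj pn pz.
Qed.

Let v_surj y : exists n, v n = y.
Proof.
have [n] := hull_all y; elim: n => [|n ih]; first by rewrite inE.
by rewrite /hull iterS in_fset1U => /predU1P[->|/ih//]; exists n.
Qed.

(** Each new vertex hangs on an earlier one, so the initial segments grow by leaves; this is the
    order in which the measure is built. *)
Lemma tree_enumeration : exists (e : nat -> G) (rk : G -> nat),
  [/\ cancel e rk, cancel rk e & forall n, (0 < n)%N ->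
      exists2 x, (rk x < n)%N & adj G x (e n)].
Proof.
pose rk y := projT1 (cid (v_surj y)).
have rkK : cancel rk v by move=> y; exact: (projT2 (cid (v_surj y))).
have vK : cancel v rk by move=> n; apply: v_inj; rewrite rkK.
exists v, rk; split=> // n n0; have [_ [[h _]|[x xn xv]]] := vP n.
  by move: (v_hull n0); rewrite h inE.
exists x => //; rewrite ltnNge; apply/negP => nx.
have : forall k, x \in hull k -> (rk x < k)%N.
  elim=> [|k ih]; first by rewrite inE.
  by rewrite /hull iterS in_fset1U => /predU1P[->|/ih/leqW//]; rewrite vK.
by move=> /(_ n xn); rewrite ltnNge nx.
Qed.

End enumeration.

Section hull.
Variables (e : nat -> G) (rk : G -> nat).
Hypotheses (eK : cancel e rk) (rkK : cancel rk e).
Hypothesis e_adj : forall n, (0 < n)%N -> exists2 x, (rk x < n)%N & adj G x (e n).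

Definition first_vertices n : {fset G} := [fset e i | i in iota 0 n]%fset.

Lemma in_first_vertices n x : (x \in first_vertices n) = (rk x < n)%N.
Proof.
apply/imfsetP/idP => [[i /=]|rkx]; first by rewrite mem_iota => /= ltin ->; rewrite eK.
by exists (rk x); rewrite ?rkK//= mem_iota.
Qed.

Lemma first_verticesS n : first_vertices n.+1 = (e n |` first_vertices n)%fset.
Proof.
apply/fsetP => x; rewrite in_fset1U !in_first_vertices ltnS leq_eqVlt.
by rewrite (can2_eq rkK eK).
Qed.

Lemma fconnected_first_vertices n : fconnected (first_vertices n).
Proof.
elim: n => [|n ih]; first by move=> x y; rewrite in_first_vertices.
rewrite first_verticesS; have [->|n0] := posnP n.
  move=> x y; rewrite !in_fset1U !in_first_vertices !orbF => /eqP -> /eqP ->.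
  by exists [::].
have [x rx xe] := e_adj n0.
by apply: fconnected_extend xe; rewrite ?in_first_vertices.
Qed.

Lemma sub_first_vertices (A : set G) : finite_set A ->
  exists n, forall x, A x -> x \in first_vertices n.
Proof.
move=> /finite_fsetP[L ->]; exists (\max_(x <- L) rk x).+1 => x /= xL.
by rewrite in_first_vertices ltnS; exact: leq_bigmax_seq.
Qed.

End hull.

Lemma finite_neighbours x : finite_set [set y | adj G x y].
Proof. by apply/finite_setP; exists d.+1; exact: adj_regular. Qed.

Lemma card_neighbours L x : (forall y, adj G x y -> y \in L) ->
  count (adj G x) L = d.+1.
Proof.
move=> xL; have := @adj_regular _ G x.
have -> : [set y | adj G x y] = [set` [fset y in L | adj G x y]%fset].
  apply/seteqP; split=> y /=; rewrite !inE/=; last by case/andP.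
  by move=> xy; rewrite xL.
move=> /card_eq_fsetP <-; rewrite -size_filter; apply: perm_size.
apply: uniq_perm; rewrite ?filter_uniq ?fset_uniq// => y.
by rewrite mem_filter !inE/= andbC.
Qed.

End tree.

(** * Probabilities with prescribed word weights *)

Section unit_uniform.
Context {R : realType}.

Let m01 : measurable (`[0, 1[%classic : set (measurableTypeR R)).
Proof. exact: measurable_itv. Qed.

Definition unit_uniform : set (measurableTypeR R) -> \bar R :=
  mrestr (@lebesgue_measure R) m01.

HB.instance Definition _ := Measure.on unit_uniform.

Let unit_uniformT : unit_uniform setT = 1%E.
Proof.
by rewrite /unit_uniform /mrestr setTI/= lebesgue_measure_itv/= lte_fin ltr01 oppr0 adde0.
Qed.

HB.instance Definition _ := Measure_isProbability.Build _ _ _ unit_uniform unit_uniformT.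

End unit_uniform.

Section word_probability.
Context {R : realType} {T : countType} (t0 : T) (p : seq T -> R).
Hypothesis p_ge0 : forall s, 0 <= p s.
Hypothesis p_nil : p [::] = 1.
Hypothesis p_rcons : forall s,
  (\esum_(t in [set: T]) (p (rcons s t))%:E = (p s)%:E)%E.

(** The weight of the letter with code i after the word s, and 0 if i codes no letter; [G] below is
    its cumulative sum. *)
Let w (s : seq T) (i : nat) : R := oapp (fun t => p (rcons s t)) 0 (pickle_inv i : option T).

Let G (s : seq T) (n : nat) : R := \sum_(0 <= i < n) w s i.

Let w_ge0 s i : 0 <= w s i. Proof. by rewrite /w; case: (pickle_inv i) => /=. Qed.

Let wE s t : w s (choice.pickle t) = p (rcons s t).
Proof. by rewrite /w pickleK_inv. Qed.

Let G_mono s m n : (m <= n)%N -> G s m <= G s n.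
Proof.
move=> mn; rewrite /G (big_cat_nat (leq0n m) mn)/= lerDl.
exact: sumr_ge0.
Qed.

Let GS s n : G s n.+1 = G s n + w s n.
Proof. by rewrite /G big_nat_recr. Qed.

Let G_sum s : (\sum_(i <oo) (w s i)%:E = (p s)%:E)%E.
Proof.
rewrite -p_rcons esum_unpickle; last by move=> t; rewrite lee_fin.
apply: eq_eseriesr => i _.
by rewrite /w /unpickle_or; case: (pickle_inv i).
Qed.

Let G_le s n : G s n <= p s.
Proof.
by rewrite -lee_fin -G_sum -sumEFin; apply: nneseries_lim_ge => i _; rewrite lee_fin.
Qed.

Let G_reach s x : x < p s -> exists n, x < G s n.
Proof.
move=> xp; apply: contrapT => h; have : ((p s)%:E <= x%:E)%E; last first.
  by rewrite lee_fin leNgt xp.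
rewrite -G_sum; apply: lime_le.
  by apply: is_cvg_nneseries => i _ _; rewrite lee_fin.
apply: nearW => n; rewrite sumEFin lee_fin leNgt; apply/negP => xn.
by apply: h; exists n.
Qed.

(** The interval of a word starts where those of its siblings with smaller last letter end. The
    recursion runs on the reversed word, whose head is the last letter. *)
Let left_end (s : seq T) : R :=
  (fix F r := if r is t :: r' then F r' + G (rev r') (choice.pickle t) else 0) (rev s).

Let left_end_rcons s t : left_end (rcons s t) = left_end s + G s (choice.pickle t).
Proof. by rewrite /left_end rev_rcons revK. Qed.

(** Half-open intervals of length p s, so that the intervals of the one-letter extensions tile that
    of s without overlap. *)
Let I (s : seq T) : set R := `[left_end s, left_end s + p s[%classic.

Let IP s u : I s u <-> left_end s <= u < left_end s + p s.
Proof. by rewrite /I /= in_itv. Qed.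

Let I_rcons s t u : I (rcons s t) u <->
  G s (choice.pickle t) <= u - left_end s < G s (choice.pickle t).+1.
Proof.
rewrite IP left_end_rcons GS wE; split=> /andP[h1 h2]; apply/andP; split; lra.
Qed.

Let I_sub s t : I (rcons s t) `<=` I s.
Proof.
move=> u /I_rcons /andP[h1 h2]; apply/IP.
have h3 := G_le s (choice.pickle t).+1; have h4 := G_mono s (leq0n (choice.pickle t)).
by move: h4; rewrite {1}/G big_geq// => h4; apply/andP; split; lra.
Qed.

Let I_uniq s t t' u : I (rcons s t) u -> I (rcons s t') u -> t = t'.
Proof.
wlog tt' : t t' / (choice.pickle t <= choice.pickle t')%N.
  by move=> h; case: (leqP (choice.pickle t) (choice.pickle t')) => [|/ltnW] /h //;
    move=> h1 h2 h3; rewrite h1.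
move=> /I_rcons /andP[h1 h2] /I_rcons /andP[h3 h4].
apply: (pcan_inj choice.pickleK); apply/eqP; rewrite eqn_leq tt' leqNgt.
apply/negP => /(G_mono s) h5; lra.
Qed.

Let I_cover s u : I s u -> exists t, I (rcons s t) u.
Proof.
move=> /IP/andP[h1 h2]; have [|n0 h0] := @G_reach s (u - left_end s); first lra.
(* The least n whose cumulative weight exceeds the offset of u. Its own weight is then nonzero, so n
   is the code of a letter. *)
have := ex_minnP (ex_intro (fun n => u - left_end s < G s n) n0 h0).
case=> -[|n] hn nmin; first by move: hn; rewrite /G big_geq//; lra.
have hn' : G s n <= u - left_end s.
  by rewrite leNgt; apply/negP => /nmin; rewrite ltnn.
have : w s n != 0.
  by apply/eqP => wn; move: hn; rewrite GS wn; lra.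
rewrite /w; have := @pickle_invK T n; case: (pickle_inv n) => /= [t tn _|]; last by rewrite eqxx.
by exists t; apply/I_rcons; rewrite tn hn'.
Qed.

Let pick s u : T := xget t0 [set t | I (rcons s t) u].

Let word u := fix W n := if n is n'.+1 then rcons (W n') (pick (W n') u) else [::].

Let X u n := pick (word u n) u.

Let wordE u n : word u n = mkseq (X u) n.
Proof. by elim: n => //= n {1}->; rewrite mkseqS. Qed.

Let I_word u n : I [::] u -> I (word u n) u.
Proof.
move=> Iu; elim: n => [//|n /I_cover [t It]] /=; rewrite /pick.
by case: xgetP => [t' _ //|/(_ t)].
Qed.

Let wordP s u : I s u -> word u (size s) = s.
Proof.
elim/last_ind: s => [//|s t ih] Ist; rewrite size_rcons /= (ih (I_sub Ist)).
congr rcons; rewrite /pick; case: xgetP => [t' _ It'|/(_ t)]; last by [].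
exact: I_uniq It' Ist.
Qed.

Let I_nil : I [::] = `[0, 1[%classic.
Proof. by rewrite /I /left_end /= p_nil add0r. Qed.

(** On [0, 1), lying in the interval of s means exactly that the digit sequence starts with s:
    nesting gives one direction, disjointness and covering of the extensions the other. *)
Let IE s : I s = `[0, 1[%classic `&` [set u | mkseq (X u) (size s) = s].
Proof.
apply/seteqP; split=> u.
  move=> Iu; split; last by rewrite /= -wordE wordP.
  rewrite -I_nil; elim/last_ind: s Iu => // s t ih /I_sub; exact: ih.
by rewrite -I_nil => -[/(I_word (size s)) + /= ms]; rewrite wordE ms.
Qed.

(** Off [0, 1), a null set of [unit_uniform], the digits are those of 0, hence constant there; this
    settles measurability outside the unit interval. *)
Let clamp (u : R) : R := if 0 <= u < 1 then u else 0.

Let clampE u : `[0, 1[%classic u -> clamp u = u.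
Proof. by rewrite /= in_itv /clamp => /= ->. Qed.

Let measurableI_ s : measurable (I s : set (measurableTypeR R)).
Proof. exact: measurable_itv. Qed.

(** An explicit extension theorem: the letters are the digits of a uniform point of [0, 1) in the
    nested subdivision, and a word has probability the length of its interval. *)
Lemma word_probability : exists (P : probability (measurableTypeR R) R)
    (Y : measurableTypeR R -> nat -> T),
  (forall n t, measurable [set u | Y u n = t]) /\
  (forall s, P [set u | mkseq (Y u) (size s) = s] = (p s)%:E).
Proof.
exists unit_uniform, (fun u => X (clamp u)); split=> [n t|s].
- pose A := [set u | X u n = t] : set R.
  have mA : measurable (`[0, 1[%classic `&` A : set (measurableTypeR R)).
    (* The n-th digit is t on the intervals of all words of length n followed by t, and there are
       countably many such words. *)
    have -> : `[0, 1[%classic `&` A =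
        \bigcup_(s in [set s : seq T | size s = n]) I (rcons s t).
      apply/seteqP; split=> u.
        move=> [u01 Au]; exists (mkseq (X u) n); first by rewrite /= size_mkseq.
        by rewrite IE; split=> //=; rewrite size_rcons size_mkseq mkseqS Au.
      move=> [s /= sn]; rewrite IE => -[u01 /=].
      by rewrite size_rcons mkseqS sn => /eqP; rewrite eqseq_rcons => /andP[_ /eqP].
    rewrite bigcup_mkcond; apply: countable_bigcupT_measurable; first exact: countableP.
    move=> s;
    case: ifP => // _; exact: measurableI_.
  rewrite [X in measurable X](_ : _ = (`[0, 1[%classic `&` A) `|`
      (~` `[0, 1[%classic `&` [set _ | A 0])); last first.
    apply/seteqP; split=> u /=; rewrite /clamp in_itv/=; case: ifP => u01.
    + by left.
    + by right; split=> //; apply/negP; rewrite u01.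
    + by case=> -[].
    + by case=> -[].
  apply: measurableU => //; apply: measurableI.
    by apply: measurableC; exact: measurable_itv.
  have [A0|A0] := pselect (A 0).
    by rewrite (_ : [set _ | _] = setT)//; apply/seteqP; split.
  by rewrite (_ : [set _ | _] = set0)//; apply/seteqP; split.
- rewrite /= /unit_uniform /mrestr.
  rewrite [X in lebesgue_measure X](_ : _ = I s); last first.
    rewrite IE; apply/seteqP; split=> u [/= h1 h2]; split=> //=.
      by rewrite clampE in h1.
    by rewrite clampE.
  rewrite /I lebesgue_measure_itv/= lte_fin ltrDl.
  have := p_ge0 s; rewrite le_eqVlt => /predU1P[<-|->].
    by rewrite ltxx.
  by rewrite EFinD addeAC subee// add0e.
Qed.

End word_probability.

(** * Tree-indexed Markov chains *)

Section cylinder.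
Context {d : nat} (G : cayley_tree d) {k : nat}.
Implicit Types (L : {fset G}) (w z : config G k).

Definition cylinder L w : set (mconfig G k) := [set z | forall x, x \in L -> z x = w x].

Definition update w y j : config G k := fun x => if x == y then j else w x.

Lemma measurable_coord x j : measurable ([set z | z x = j] : set (mconfig G k)).
Proof. by apply: sub_sigma_algebra; exists x, j. Qed.

Lemma measurable_cylinder L w : measurable (cylinder L w).
Proof.
have -> : cylinder L w = \bigcap_x (if x \in L then [set z | z x = w x] else setT).
  apply/seteqP; split=> z zw x; first by move=> _; case: ifP => // xL; exact: zw.
  by move=> xL; have := zw x I; rewrite xL.
rewrite -[X in measurable X]setCK setC_bigcap; apply: measurableC.
apply: countable_bigcupT_measurable => [|x]; first exact: countableP.
by apply: measurableC; case: ifP => // _; exact: measurable_coord.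
Qed.

Lemma cylinder_update L w y : y \notin L ->
  cylinder L w = \bigcup_j cylinder (y |` L)%fset (update w y j).
Proof.
move=> yL; apply/seteqP; split=> [z zw|z [j _ zw] x xL].
  exists (z y) => // x; rewrite !inE /update; case: eqP => [->//|_ /=]; exact: zw.
by rewrite zw ?in_fset1U ?xL ?orbT// /update ifN//; apply: contraNneq yL => <-.
Qed.

Lemma trivIset_update L w y :
  trivIset setT (fun j => cylinder (y |` L)%fset (update w y j)).
Proof.
move=> i j _ _ [z [/(_ y) zi /(_ y) zj]].
by move: zi zj; rewrite in_fset1U eqxx /update eqxx => ->// ->.
Qed.

Variables (e : nat -> G) (rk : G -> nat).
Hypotheses (eK : cancel e rk) (rkK : cancel rk e).

Let inV := in_first_vertices eK rkK.

(** Two cylinders over initial segments are nested or disjoint, so together with the empty set they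
    form a pi-system. *)
Let Cyl : set (set (mconfig G k)) :=
  [set A | A = set0 \/ exists n w, A = cylinder (first_vertices e n) w].

Let Cyl_setI : setI_closed Cyl.
Proof.
have wl n m w w' : (n <= m)%N ->
    Cyl (cylinder (first_vertices e n) w `&` cylinder (first_vertices e m) w').
  move=> nm; have [ww'|ww'] := pselect (forall x, x \in first_vertices e n -> w' x = w x).
    right; exists m, w'; apply/seteqP; split=> [z []//|z zw]; split=> // x xn.
    by rewrite zw ?ww'// inV (leq_trans _ nm)// -inV.
  left; apply/seteqP; split=> // z [zw zw']; apply: ww' => x xn.
  by rewrite -zw// zw'// inV (leq_trans _ nm)// -inV.
move=> _ _ [->|[n [w ->]]] [->|[m [w' ->]]]; rewrite ?set0I ?setI0; try by left.
by have [nm|/ltnW mn] := leqP n m; [|rewrite setIC]; exact: wl.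
Qed.

(** The event that x carries the spin j is a countable union of cylinders over the initial segment
    ending at x, one for each word with last letter j. *)
Let sigma_Cyl : (@measurable _ (mconfig G k) : set (set (config G k))) = <<s Cyl >>.
Proof.
apply/seteqP; split.
  apply: smallest_sub; first exact: smallest_sigma_algebra.
  move=> _ [x [j ->]].
  pose D := [set s : seq 'rV[int]_k | size s = (rk x).+1 /\ nth 0 s (rk x) = j].
  have -> : [set w : config G k | w x = j] = \bigcup_s (if s \in D then
      cylinder (first_vertices e (rk x).+1) (fun y => nth 0 s (rk y)) else set0).
    apply/seteqP; split=> [z zx|z [s _]].
      exists (mkseq (z \o e) (rk x).+1) => //.
      rewrite ifT; last first.
        by apply/mem_set; split; rewrite ?size_mkseq// nth_mkseq//= rkK.
      by move=> y; rewrite inV => yx; rewrite nth_mkseq//= rkK.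
    case: ifPn => // /set_mem [_ <-] /(_ x); apply.
    by rewrite inV.
  apply: (@countable_bigcupT_measurable _ (g_sigma_algebraType Cyl)).
    exact: countableP.
  move=> s; case: ifPn => _; last exact: measurable0.
  by apply: sub_sigma_algebra; right; exists (rk x).+1, (fun y => nth 0 s (rk y)).
apply: smallest_sub; first exact: sigma_algebra_measurable.
by move=> _ [->|[n [w ->]]]; [exact: measurable0|exact: measurable_cylinder].
Qed.

Lemma cylinder_measure_unique (R : realType) (m1 m2 : {measure set (mconfig G k) -> \bar R}) :
  (forall n w, m1 (cylinder (first_vertices e n) w) = m2 (cylinder (first_vertices e n) w)) ->
  (m1 setT < +oo)%E ->
  forall A, measurable A -> m1 A = m2 A.
Proof.
move=> m12 m1oo; apply: (@measure_unique _ _ _ Cyl (fun=> setT)) => //.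
- move=> _; right; exists 0%N, (fun=> 0); apply/seteqP; split=> // z _ x.
  by rewrite inV.
- by apply/seteqP; split=> // z _; exists 0%N.
- by move=> _ [->|[n [w ->]]]; rewrite ?measure0.
Qed.

End cylinder.

(** * Consistent weights on finite connected sets and the measure they define *)

Section tree_weight.
Context {R : realType} {d : nat} (G : cayley_tree d) {k : nat}.
Variables (pi g : 'rV[int]_k -> R) (r : 'rV[int]_k -> 'rV[int]_k -> R).
Implicit Types (L : {fset G}) (w z : config G k).

(** The inner product runs over ordered pairs, so an edge ab inside [L] contributes g(a) g(b) r(a,
    b) r(b, a). Neither a root nor an orientation enters the formula. *)
Definition tree_weight L w : R := \prod_(x <- L) (pi (w x) *
  \prod_(y <- L | adj G x y) (g (w x) * r (w x) (w y))).

Lemma tree_weight_eq L w z : (forall x, x \in L -> w x = z x) ->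
  tree_weight L w = tree_weight L z.
Proof.
move=> wz; apply: eq_big_seq => x xL; rewrite wz//; congr (_ * _).
by rewrite big_seq_cond [RHS]big_seq_cond; apply: eq_bigr => y /andP[yL _]; rewrite wz.
Qed.

Lemma tree_weight1 x w : tree_weight [fset x]%fset w = pi (w x).
Proof.
rewrite /tree_weight big_seq_fset1 big_mkcond big_seq_fset1.
by rewrite (@adj_irr _ G) mulr1.
Qed.

(** By acyclicity x is the only neighbour of y in L, so the new factors are those of y itself and of
    the two orientations of the edge xy. *)
Lemma tree_weight_leaf L x y w : fconnected L -> x \in L -> y \notin L ->
  adj G x y -> tree_weight (y |` L)%fset w = tree_weight L w *
  (pi (w y) * (g (w y) * r (w y) (w x)) * (g (w x) * r (w x) (w y))).
Proof.
move=> cL xL yL xy; rewrite /tree_weight.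
pose E a b := if adj G a b then g (w a) * r (w a) (w b) else 1.
have EE M a : \prod_(b <- M | adj G a b) (g (w a) * r (w a) (w b)) = \prod_(b <- M) E a b.
  by rewrite big_mkcond.
under eq_bigr do rewrite EE; under [in RHS]eq_bigr do rewrite EE.
have nbr a : a \in L -> adj G a y -> a = x.
  move=> aL ay; apply: (fconnected_neighbour_uniq cL yL) => //; rewrite adj_sym//.
have Ey : \prod_(b <- L) E y b = E y x.
  rewrite (bigD1_seq x)//= big1_seq ?mulr1// => b /andP[bx bL].
  rewrite /E ifN//; apply: contraNN bx => yb; apply/eqP; apply: nbr => //.
  by rewrite adj_sym.
have Ex : \prod_(a <- L) E a y = E x y.
  rewrite (bigD1_seq x)//= big1_seq ?mulr1// => b /andP[bx bL].
  by rewrite /E ifN//; apply: contraNN bx => yb; apply/eqP; exact: nbr.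
rewrite big_fsetU1//= big_fsetU1//= Ey.
have -> : \prod_(a <- L) (pi (w a) * \prod_(b <- (y |` L)%fset) E a b) =
    E x y * \prod_(a <- L) (pi (w a) * \prod_(b <- L) E a b).
  rewrite -Ex -big_split/=; apply: eq_bigr => a _.
  by rewrite big_fsetU1//= mulrCA.
have -> : E y y = 1 by rewrite /E (@adj_irr _ G).
have -> : E y x = g (w y) * r (w y) (w x) by rewrite /E adj_sym xy.
have -> : E x y = g (w x) * r (w x) (w y) by rewrite /E xy.
ring.
Qed.

Hypothesis pi_ge0 : forall a, 0 <= pi a.
Hypothesis g_ge0 : forall a, 0 <= g a.
Hypothesis r_ge0 : forall a b, 0 <= r a b.
Hypothesis r_sym : forall a b, r a b = r b a.
Hypothesis pi_sum : (\esum_(a in setT) (pi a)%:E = 1)%E.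
Hypothesis pi_stoch : forall a,
  (\esum_(b in setT) (pi b * g b * g a * r a b ^+ 2)%:E = 1)%E.

Lemma tree_weight_ge0 L w : 0 <= tree_weight L w.
Proof. by apply: prodr_ge0 => x _; rewrite mulr_ge0// prodr_ge0// => y _; rewrite mulr_ge0. Qed.

(** By [pi_stoch] the factor of the new leaf is a transition probability out of the spin at x, so it
    sums to one. *)
Lemma tree_weight_sum L x y w : fconnected L -> x \in L -> y \notin L ->
  adj G x y ->
  (\esum_(j in setT) (tree_weight (y |` L)%fset (update w y j))%:E
   = (tree_weight L w)%:E)%E.
Proof.
move=> cL xL yL xy.
have xNy : (x == y) = false by apply: contraNF yL => /eqP <-.
transitivity (\esum_(j in [set: 'rV[int]_k])
    ((tree_weight L w)%:E * (pi j * g j * g (w x) * r (w x) j ^+ 2)%:E))%E.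
  apply: eq_esum => j _; rewrite (tree_weight_leaf (update w y j) cL xL yL xy) -EFinM.
  have -> : tree_weight L (update w y j) = tree_weight L w.
    apply: tree_weight_eq => a aL; rewrite /update ifN//.
    by apply: contraNneq yL => <-.
  by rewrite /update eqxx xNy (r_sym j); congr EFin; ring.
rewrite esumZl ?tree_weight_ge0//.
  by rewrite pi_stoch mule1.
by move=> j; rewrite lee_fin !mulr_ge0.
Qed.

Section enumerated.
Variables (e : nat -> G) (rk : G -> nat).
Hypotheses (eK : cancel e rk) (rkK : cancel rk e).
Hypothesis e_adj : forall n, (0 < n)%N -> exists2 x, (rk x < n)%N & adj G x (e n).

Let inV := in_first_vertices eK rkK.

Let p (s : seq 'rV[int]_k) :=
  tree_weight (first_vertices e (size s)) (fun x => nth 0 s (rk x)).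

Let p_nil : p [::] = 1.
Proof.
rewrite /p /tree_weight (_ : first_vertices e _ = fset0) ?big_seq_fset0//.
by apply/fsetP => x; rewrite inV inE.
Qed.

(** A word lists the spins along the enumeration. The first letter is summed by [pi_sum]; every
    later one sits on a leaf attached to an earlier vertex. *)
Let p_rcons s : (\esum_(t in setT) (p (rcons s t))%:E = (p s)%:E)%E.
Proof.
have pE t : p (rcons s t) = tree_weight (e (size s) |` first_vertices e (size s))%fset
    (update (fun x => nth 0 s (rk x)) (e (size s)) t).
  rewrite /p size_rcons -(first_verticesS eK rkK); apply: tree_weight_eq => x.
  rewrite inV nth_rcons /update ltnS leq_eqVlt => /predU1P[xs|xs].
    by rewrite -xs rkK ltnn !eqxx.
  by rewrite xs ifN//; apply: contraTneq xs => ->; rewrite eK ltnn.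
under eq_esum do rewrite pE.
case: (posnP (size s)) => [s0|s0].
  rewrite s0 (size0nil s0) p_nil.
  have -> : first_vertices e 0 = fset0 by apply/fsetP => x; rewrite inV inE.
  rewrite -[RHS]pi_sum; apply: eq_esum => t _.
  by rewrite fsetU0 tree_weight1 /update eqxx.
have [x xs xe] := e_adj s0.
apply: (@tree_weight_sum _ x); rewrite ?inV//; last by rewrite eK ltnn.
exact: fconnected_first_vertices.
Qed.

Lemma tree_measure_enum : exists mu : probability (mconfig G k) R,
  forall n w, mu (cylinder (first_vertices e n) w)
    = (tree_weight (first_vertices e n) w)%:E.
Proof.
have [P [Y [mY PY]]] := @word_probability R 'rV[int]_k 0 p
  (fun s => tree_weight_ge0 _ _) p_nil p_rcons.
pose f u : mconfig G k := fun x => Y u (rk x).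
have mf : measurable_fun setT f.
  apply: (@measurability _ _ _ (mconfig G k) setT f (@cylinders _ G k)) => //.
  move=> _ [_ [x [j ->]] <-].
  by rewrite setTI; exact: mY.
pose F : {mfun measurableTypeR R >-> mconfig G k} :=
  HB.pack f (isMeasurableFun.Build _ _ _ _ f mf).
exists (distribution P F) => n w; rewrite /distribution /pushforward/=.
have := PY (mkseq (w \o e) n); rewrite size_mkseq => h.
transitivity (p (mkseq (w \o e) n))%:E; last first.
  congr EFin; rewrite /p size_mkseq; apply: tree_weight_eq => x.
  by rewrite inV => xn; rewrite nth_mkseq//= rkK.
rewrite -h; congr (P _); apply/seteqP; split=> u /=.
  move=> uw; apply/eq_in_map => i; rewrite mem_iota => /= ltin.
  by rewrite -uw /f ?eK// inV eK.
move=> uw x; rewrite inV => xn.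
have /(congr1 (fun s => nth 0 s (rk x))) := uw.
by rewrite !nth_mkseq//= rkK.
Qed.

(** Induction on the number of vertices of a large initial segment missing from L. While some are
    missing, a leaf of the segment is attached to L, and both sides split in the same way over its
    spin. *)
Lemma tree_measure_connected (mu : probability (mconfig G k) R) :
  (forall n w, mu (cylinder (first_vertices e n) w)
    = (tree_weight (first_vertices e n) w)%:E) ->
  forall L x, fconnected L -> x \in L -> forall w, mu (cylinder L w) = (tree_weight L w)%:E.
Proof.
move=> mu_enum L x cL xL.
have [n Ln] := sub_first_vertices eK rkK (finite_fset L).
have [m mE] := ubnP (#|` first_vertices e n `\` L|%fset).
elim: m L cL xL Ln mE => // m ih L cL xL Ln mE w.
have [nL|nL] := pselect {subset first_vertices e n <= L}.
  suff -> : L = first_vertices e n by [].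
  by apply/fsetP => z; apply/idP/idP; [exact: Ln|exact: nL].
have cn : fconnected (first_vertices e n) by exact: (fconnected_first_vertices eK rkK e_adj).
have [a [b [aL bn bL ab]]] := fconnected_grow cn Ln xL nL.
rewrite (cylinder_update _ bL) measure_esum; last 2 first.
- by move=> j; exact: measurable_cylinder.
- exact: trivIset_update.
rewrite -(tree_weight_sum w cL aL bL ab); apply: eq_esum => j _; apply: ih.
- exact: fconnected_extend ab.
- by rewrite in_fset1U xL orbT.
- by move=> z; rewrite /= in_fset1U => /predU1P[->//|/Ln].
- move: mE; rewrite ltnS; apply: leq_trans.
  have -> : (first_vertices e n `\` (b |` L) = (first_vertices e n `\` L) `\ b)%fset.
    by apply/fsetP => z; rewrite !inE negb_or andbA.
  by rewrite [ltnRHS](cardfsD1 b) in_fsetD bL bn.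
Qed.

End enumerated.

Lemma tree_measure : G -> exists mu : probability (mconfig G k) R,
  forall L x, fconnected L -> x \in L -> forall w,
    mu (cylinder L w) = (tree_weight L w)%:E.
Proof.
move=> o; have [e [rk [eK rkK e_adj]]] := tree_enumeration o.
have [mu mu_enum] := tree_measure_enum eK rkK e_adj.
by exists mu; exact: (tree_measure_connected eK rkK e_adj).
Qed.

End tree_weight.

Section large_cylinders.
Context {R : realType} {d : nat} (G : cayley_tree d) {k : nat}.

(** The cylinders over long initial segments contain L0 in their base; those over shorter ones are
    countable disjoint unions of them, reached by adding one vertex at a time. *)
Lemma large_cylinder_measure_unique (o : G) (L0 : {fset G})
    (m1 m2 : {measure set (mconfig G k) -> \bar R}) :
  (forall (L : {fset G}) x w, fconnected L -> x \in L -> {subset L0 <= L} ->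
     m1 (cylinder L w) = m2 (cylinder L w)) ->
  (m1 setT < +oo)%E -> forall A, measurable A -> m1 A = m2 A.
Proof.
move=> m12 m1oo; have [e [rk [eK rkK e_adj]]] := tree_enumeration o.
apply: (cylinder_measure_unique eK rkK) => //.
have [n0 Ln0] := sub_first_vertices eK rkK (finite_fset L0).
have large n w : (n0 < n)%N ->
    m1 (cylinder (first_vertices e n) w) = m2 (cylinder (first_vertices e n) w).
  move=> n0n; apply: (m12 _ (e 0%N)).
  - exact: (fconnected_first_vertices eK rkK e_adj).
  - by rewrite (in_first_vertices eK rkK) eK (leq_ltn_trans _ n0n).
  - move=> x /Ln0; rewrite !(in_first_vertices eK rkK) => /leq_trans; apply.
    exact: ltnW.
suff : forall j n w, (n0 < n + j)%N ->
    m1 (cylinder (first_vertices e n) w) = m2 (cylinder (first_vertices e n) w).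
  by move=> h n w; apply: (h n0.+1); rewrite addnS ltnS leq_addl.
elim=> [|j ih] n w; first by rewrite addn0; exact: large.
rewrite addnS -addSn => nj.
have en : e n \notin first_vertices e n by rewrite (in_first_vertices eK rkK) eK ltnn.
have mC i : measurable (cylinder (e n |` first_vertices e n)%fset (update w (e n) i)).
  exact: measurable_cylinder.
rewrite (cylinder_update w en).
have tC := @trivIset_update _ G k (first_vertices e n) w (e n).
rewrite (measure_esum m1 mC tC) (measure_esum m2 mC tC).
by apply: eq_esum => i _; rewrite -(first_verticesS eK rkK); exact: ih.
Qed.

End large_cylinders.

Section automorphism.
Context {R : realType} {d : nat} (G : cayley_tree d) {k : nat}.
Variables (pi g : 'rV[int]_k -> R) (r : 'rV[int]_k -> 'rV[int]_k -> R).
Variables (phi : G -> G) (phi_aut : tree_aut phi).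

Let phi_inj : injective phi. Proof. by have [/bij_inj] := phi_aut. Qed.

Let image (L : {fset G}) : {fset G} := [fset phi x | x in L]%fset.

Let fconnected_image L : fconnected L -> fconnected (image L).
Proof.
move=> cL _ _ /imfsetP[/= x xL ->] /imfsetP[/= y yL ->].
have [p [xp py pL]] := cL x y xL yL; exists (map phi p); split.
- by rewrite (mono_path (proj2 phi_aut)).
- by rewrite last_map py.
- by move=> _ /mapP[z /pL zL ->]; apply/imfsetP; exists z.
Qed.

Let tree_weight_image L w :
  tree_weight pi g r (image L) w = tree_weight pi g r L (w \o phi).
Proof.
rewrite /tree_weight /image big_imfset/=; last by move=> x y _ _ /phi_inj.
apply: eq_bigr => x _; congr (_ * _).
rewrite big_mkcond [RHS]big_mkcond big_imfset/=; last by move=> y z _ _ /phi_inj.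
by apply: eq_bigr => y _; rewrite (proj2 phi_aut).
Qed.

(** The pushforward gives a cylinder over L the mass of a cylinder over the image of L, and the
    weight depends on L through adjacency alone, which the automorphism preserves. *)
Lemma tree_measure_invariant (mu : probability (mconfig G k) R) :
  (forall (L : {fset G}) x, fconnected L -> x \in L -> forall w,
    mu (cylinder L w) = (tree_weight pi g r L w)%:E) ->
  forall A : set (mconfig G k), measurable A ->
    mu [set w : config G k | A (w \o phi)] = mu A.
Proof.
move=> muE A mA; have [psi phiK psiK] := proj1 phi_aut.
have [root _] := fset_notin (fset0 : {fset G}).
pose f (w : mconfig G k) : mconfig G k := w \o phi.
have mf : measurable_fun setT f.
  apply: (@measurability _ _ _ (mconfig G k) setT f (@cylinders _ G k)) => //.
  move=> _ [_ [x [j ->]] <-].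
  by rewrite setTI; exact: (measurable_coord (phi x) j).
pose F : {mfun mconfig G k >-> mconfig G k} :=
  HB.pack f (isMeasurableFun.Build _ _ _ _ f mf).
suff : forall A, measurable A -> distribution mu F A = mu A by exact.
apply: (large_cylinder_measure_unique root (L0 := fset0)); last first.
  by rewrite -ge0_fin_numE ?measure_ge0//; exact: (fin_num_measure (distribution mu F)).
move=> L x w cL xL _; transitivity (tree_weight pi g r L w)%:E; last exact/esym/(muE L x).
transitivity (mu (F @^-1` cylinder L w)); first by [].
have -> : F @^-1` cylinder L w = cylinder (image L) (w \o psi).
  apply/seteqP; split=> z /= zw.
    by move=> _ /imfsetP[/= y yL ->]; rewrite phiK -zw.
  by move=> y yL; rewrite /f/= zw/= ?phiK//; apply/imfsetP; exists y.
rewrite (muE _ (phi x)); last 2 first.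
- exact: fconnected_image.
- by apply/imfsetP; exists x.
rewrite tree_weight_image; congr EFin; apply: tree_weight_eq => y _.
by rewrite /= phiK.
Qed.

End automorphism.

(** * The Gibbs property *)

Section patch.
Context {d : nat} (G : cayley_tree d) {k : nat} (L : {fset G}).
Implicit Types (w z : config G k) (zeta : {ffun L -> 'rV[int]_k}).

(** Coding the spins on L as a finite function gives a countable index set that does not depend on
    w, so the sums over [agree_off L w] become series of functions of w. *)
Definition patch zeta w : config G k :=
  fun x => if insub x is Some y then zeta y else w x.

Lemma patch_out zeta w x : x \notin L -> patch zeta w x = w x.
Proof. by move=> xL; rewrite /patch insubN. Qed.

Lemma patch_local zeta w z x : w x = z x -> patch zeta w x = patch zeta z x.
Proof. by move=> wz; rewrite /patch; case: insub. Qed.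

Lemma patch_restrict w z x : x \in L -> patch [ffun y => w (val y)] z x = w x.
Proof. by move=> xL; rewrite /patch insubT ffunE. Qed.

Lemma patch_agree_off w : set_bij setT (agree_off L w) (patch ^~ w).
Proof.
split.
- by move=> zeta _ x xL; exact: patch_out.
- move=> z1 z2 _ _ h; apply/ffunP => y; have := congr1 (fun f => f (val y)) h.
  by rewrite /patch valK.
- move=> z zw; exists [ffun y => z (val y)] => //; apply/funext => x.
  have [xL|xL] := boolP (x \in L); first by rewrite patch_restrict.
  by rewrite patch_out// zw.
Qed.

Lemma measurable_patch zeta :
  measurable_fun setT (patch zeta : mconfig G k -> mconfig G k).
Proof.
apply: (@measurability _ _ _ (mconfig G k) setT _ (@cylinders _ G k)) => //.
move=> _ [_ [x [j ->]] <-]; rewrite setTI /preimage /=.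
have [xL|xL] := boolP (x \in L).
  have [zj|zj] := pselect (zeta [` xL]%fset = j).
    rewrite (_ : [set _ | _] = setT)//; apply/seteqP; split=> // w _ /=.
    by rewrite /patch insubT.
  rewrite (_ : [set _ | _] = set0)//; apply/seteqP; split=> // w /=.
  by rewrite /patch insubT.
rewrite (_ : [set _ | _] = [set w | w x = j]); first exact: measurable_coord.
by apply/seteqP; split=> w /=; rewrite patch_out.
Qed.

End patch.

(** A function of finitely many spins is constant on each of countably many cylinders, so its
    preimages are countable unions of them. *)
Lemma measurable_local (d : nat) (G : cayley_tree d) k d' (T : measurableType d')
    (M : {fset G}) (h : mconfig G k -> T) :
  (forall w z : config G k, (forall x, x \in M -> w x = z x) -> h w = h z) ->
  measurable_fun setT h.
Proof.
move=> hM _ B mB; rewrite setTI.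
pose w0 : config G k := fun=> 0.
have -> : h @^-1` B = \bigcup_(s : {ffun M -> 'rV[int]_k})
    (if h (patch s w0) \in B then cylinder M (patch s w0) else set0).
  apply/seteqP; split=> [z Bz|z [s _]].
    exists [ffun y => z (val y)] => //; rewrite (hM _ z) ?mem_set//.
      by move=> x xM; rewrite patch_restrict.
    by move=> x xM; rewrite patch_restrict.
  by case: ifPn => // /set_mem Bs /= zs; rewrite /preimage/= (hM _ (patch s w0)).
apply: countable_bigcupT_measurable; first exact: countableP.
by move=> s; case: ifP => // _; exact: measurable_cylinder.
Qed.

Lemma closed_neighbourhood (d : nat) (G : cayley_tree d) (L : {fset G}) :
  exists M : {fset G}, {subset L <= M} /\
    forall x y, x \in L -> adj G x y -> y \in M.
Proof.
have fin : finite_set ([set` L] `|` \bigcup_(x in [set` L]) [set y | adj G x y]).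
  rewrite finite_setU; split; first exact: finite_fset.
  apply: bigcup_finite; first exact: finite_fset.
  by move=> x _; exact: finite_neighbours.
move/finite_fsetP: fin => [M ME]; exists M; split=> [x xL|x y xL xy].
  by have : [set` M] x by rewrite -ME; left.
by have : [set` M] y by rewrite -ME; right; exists x.
Qed.

Section boltzmann.
Context {R : realType} {d : nat} (G : cayley_tree d) {k : nat}.
Variables (Q : 'rV[int]_k -> R) (L M : {fset G}).
Hypothesis LM : {subset L <= M}.
Hypothesis nbrM : forall x y, x \in L -> adj G x y -> y \in M.
Implicit Types (w z : config G k).

Lemma boltzmannE w : boltzmann Q L w = \prod_(x <- M) \prod_(y <- M | adj G x y &&
  ((x \in L) || (y \in L)) && (choice.pickle x < choice.pickle y)%N) Q (w x - w y).
Proof.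
pose c (e : G * G) := adj G e.1 e.2 && ((e.1 \in L) || (e.2 \in L)) &&
  (choice.pickle e.1 < choice.pickle e.2)%N.
have -> : \prod_(x <- M) \prod_(y <- M | c (x, y)) Q (w x - w y) =
    \prod_(e <- [seq (x, y) | x <- M, y <- M] | c e) Q (w e.1 - w e.2).
  by rewrite [RHS]big_mkcond big_allpairs/=; apply: eq_bigr => x _; rewrite big_mkcond.
rewrite -big_filter /boltzmann.
have -> : edges_meeting L = [set` [fset e in [seq e <- [seq (x, y) | x <- M, y <- M] | c e]]%fset].
  apply/seteqP; split=> -[x y] /=; rewrite !inE mem_filter /c/=.
    move=> [xy pxy L2]; rewrite xy pxy L2/=; apply/allpairsP; exists (x, y) => /=.
    case/orP: L2 => [xL|yL]; split=> //; try exact: LM; first exact: nbrM xy.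
    by apply: nbrM yL _; rewrite adj_sym.
  by case/andP => /andP[/andP[]].
rewrite fsbig_finite//= set_fsetK; apply: perm_big; apply: uniq_perm.
- exact: fset_uniq.
- rewrite filter_uniq// allpairs_uniq ?fset_uniq//.
  by move=> [? ?] [? ?] _ _ /= [-> ->].
- by move=> e; rewrite !inE.
Qed.

Lemma boltzmann_local w z : (forall x, x \in M -> w x = z x) ->
  boltzmann Q L w = boltzmann Q L z.
Proof.
move=> wz; rewrite !boltzmannE; apply: eq_big_seq => x xM.
rewrite big_seq_cond [RHS]big_seq_cond; apply: eq_bigr => y /andP[yM _].
by rewrite !wz.
Qed.

Hypothesis Q_gt0 : forall j, 0 < Q j.

Lemma boltzmann_gt0 w : 0 < boltzmann Q L w.
Proof. by rewrite boltzmannE; apply: prodr_gt0 => x _; apply: prodr_gt0. Qed.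

Let boltzmann_ge0 w : 0 <= boltzmann Q L w. Proof. exact/ltW/boltzmann_gt0. Qed.

Lemma partition_functionE w : partition_function Q L w =
  (\esum_(zeta in [set: {ffun L -> 'rV[int]_k}]) (boltzmann Q L (patch zeta w))%:E)%E.
Proof.
rewrite /partition_function.
by rewrite (reindex_esum setT _ (fun zeta => patch zeta w) _ (patch_agree_off L w)).
Qed.

Lemma partition_function_gt0 w : (0 < partition_function Q L w)%E.
Proof.
apply: (@lt_le_trans _ _ (boltzmann Q L w)%:E); first by rewrite lte_fin boltzmann_gt0.
by apply: (@esum_ge_term _ _ (agree_off L w) (fun z => (boltzmann Q L z)%:E)).
Qed.

Lemma partition_function_local w z : (forall x, x \in M -> x \notin L -> w x = z x) ->
  partition_function Q L w = partition_function Q L z.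
Proof.
move=> wz; rewrite !partition_functionE; apply: eq_esum => zeta _; congr EFin.
apply: boltzmann_local => x xM; have [xL|xL] := boolP (x \in L).
  by rewrite /patch insubT.
by apply: patch_local; exact: wz.
Qed.

(** This includes an infinite partition function, whose inverse is 0. *)
Let partition_functionVE w : exists c : R, 0 <= c /\ ((partition_function Q L w)^-1 = c%:E)%E.
Proof.
have := partition_function_gt0 w; case: inveP => [|_|//|r r0 r1].
- by rewrite ltxx.
- by exists 0.
- by exists r^-1; split=> //; rewrite invr_ge0 ltW// -lte_fin.
Qed.

Let numeratorE w A : (\esum_(z in agree_off L w `&` A) (boltzmann Q L z)%:E =
  \esum_(zeta in [set: {ffun L -> 'rV[int]_k}])
    (boltzmann Q L (patch zeta w))%:E * (\1_(patch zeta @^-1` A) w)%:E)%E.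
Proof.
rewrite esum_mkcondr (reindex_esum setT _ (fun zeta => patch zeta w) _ (patch_agree_off L w)).
apply: eq_esum => zeta _; rewrite indicE.
have -> : (w \in patch zeta @^-1` A) = (patch zeta w \in A) by [].
by case: ifP; rewrite ?mule1 ?mule0.
Qed.

Let local_boltzmann (zeta : {ffun L -> 'rV[int]_k}) : measurable_fun setT
  (fun w : mconfig G k => (boltzmann Q L (patch zeta w))%:E).
Proof.
apply: (measurable_local (M := M)) => w z wz; congr EFin.
by apply: boltzmann_local => x xM; apply: patch_local; exact: wz.
Qed.

Lemma gibbs_kernel_ge0 A w : (0 <= gibbs_kernel Q L A w)%E.
Proof.
have [c [c0 cE]] := partition_functionVE w; rewrite /gibbs_kernel cE mule_ge0//.
by apply: esum_ge0 => z _; rewrite lee_fin.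
Qed.

Lemma measurable_gibbs_kernel (A : set (mconfig G k)) : measurable A ->
  measurable_fun setT (gibbs_kernel Q L A : mconfig G k -> \bar R).
Proof.
move=> mA; apply: emeasurable_funM; last first.
  apply: (measurable_local (M := M)) => w z wz; congr (inve _).
  by apply: partition_function_local => x xM _; exact: wz.
rewrite (_ : (fun _ => _) = fun w : mconfig G k => (\sum_(n <oo) unpickle_or
   (fun zeta : {ffun L -> 'rV[int]_k} =>
     (boltzmann Q L (patch zeta w))%:E * (\1_(patch zeta @^-1` A) w)%:E)%E n)%E); last first.
  apply/funext => w; rewrite numeratorE esum_unpickle// => zeta.
  by rewrite -EFinM lee_fin mulr_ge0.
apply: (ge0_emeasurable_sum (P := xpredT)) => [n w _ _|n _].
  rewrite /unpickle_or; case: pickle_inv => //= zeta.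
  by rewrite -EFinM lee_fin mulr_ge0.
rewrite /unpickle_or; case: pickle_inv => [zeta|]/=; last exact: measurable_cst.
apply: emeasurable_funM; first exact: local_boltzmann.
apply/measurable_EFinP; apply: measurable_indic.
by rewrite -[X in measurable X]setTI; exact: measurable_patch.
Qed.

Variable mu : {measure set (mconfig G k) -> \bar R}.

(** This is mu gamma_L. Once it is known to be a measure, the DLR equation can be tested on
    cylinders. *)
Definition gibbs_average (A : set (mconfig G k)) : \bar R :=
  (\int[mu]_w gibbs_kernel Q L A w)%E.

Lemma gibbs_average0 : gibbs_average set0 = 0%E.
Proof.
by apply: integral0_eq => w _; rewrite /gibbs_kernel setI0 esum_set0 mul0e.
Qed.

Lemma gibbs_average_ge0 A : (0 <= gibbs_average A)%E.
Proof. by apply: integral_ge0 => w _; exact: gibbs_kernel_ge0. Qed.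

Lemma gibbs_average_sigma_additive : semi_sigma_additive gibbs_average.
Proof.
move=> F mF tF _.
have -> : gibbs_average (\bigcup_n F n) = (\sum_(n <oo) gibbs_average (F n))%E.
  rewrite /gibbs_average -integral_nneseries//; last 2 first.
  - by move=> n; exact: measurable_gibbs_kernel.
  - by move=> n w _; exact: gibbs_kernel_ge0.
  apply: eq_integral => w _; rewrite /gibbs_kernel setI_bigcupr.
  rewrite nneseries_sum_bigcup//; last first.
    by apply: trivIset_setIl.
  have [c [c0 ->]] := partition_functionVE w; rewrite muleC -nneseriesZl.
    by apply: eq_eseriesr => n _; rewrite muleC.
  by move=> n _; apply: esum_ge0 => z _; rewrite lee_fin.
apply: is_cvg_nneseries => n _ _; exact: gibbs_average_ge0.
Qed.

End boltzmann.

(** * The DLR equations for the tree measure *)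

Section tree_gibbs.
Context {R : realType} {d : nat} (G : cayley_tree d) {k : nat}.
Variables (pi g : 'rV[int]_k -> R) (r : 'rV[int]_k -> 'rV[int]_k -> R).
Variables (Q : 'rV[int]_k -> R) (kappa : R).
Hypothesis pi_gt0 : forall a, 0 < pi a.
Hypothesis g_gt0 : forall a, 0 < g a.
Hypothesis r_gt0 : forall a b, 0 < r a b.
Hypothesis r_sym : forall a b, r a b = r b a.
Hypothesis rQ : forall a b, r a b ^+ 2 = Q (a - b).
Hypothesis pi_g : forall a, pi a * g a ^+ d.+1 = kappa.

Let Q_gt0 j : 0 < Q j.
Proof. by rewrite -[j]subr0 -rQ exprn_gt0. Qed.

Section weight.
Variables (L M : {fset G}).
Hypothesis LM : {subset L <= M}.
Hypothesis nbrM : forall x y, x \in L -> adj G x y -> y \in M.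

Let inner (x y : G) := adj G x y && ~~ ((x \in L) || (y \in L)).

(* Every factor of the tree weight that involves a spin in L is a factor of
   the Boltzmann weight, because pi * g ^ (d + 1) is constant. *)
Let rest (z : config G k) : R :=
  (\prod_(x <- M) (if x \in L then kappa else
     pi (z x) * \prod_(y <- M | adj G x y) g (z x))) *
  \prod_(x <- M) \prod_(y <- M | inner x y) r (z x) (z y).

Let rest_local w z : (forall x, x \in M -> x \notin L -> w x = z x) -> rest w = rest z.
Proof.
move=> wz; rewrite /rest; congr (_ * _).
  by apply: eq_big_seq => x xM; case: ifPn => // xL; rewrite wz.
apply: eq_big_seq => x xM.
rewrite big_seq_cond [RHS]big_seq_cond; apply: eq_bigr => y.
by rewrite /inner negb_or => /andP[yM /andP[_ /andP[xL yL]]]; rewrite !wz.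
Qed.

Let rest_gt0 z : 0 < rest z.
Proof.
apply: mulr_gt0; apply: prodr_gt0 => x _; last exact: prodr_gt0.
case: ifP => _; first by rewrite -(pi_g 0) mulr_gt0 ?exprn_gt0.
by rewrite mulr_gt0// prodr_gt0.
Qed.

Let outer (x y : G) := adj G x y && ((x \in L) || (y \in L)).

(** The Boltzmann weight has one factor Q = r^2 per edge; the two square roots are distributed over
    the two orientations. *)
Let boltzmann_outer z :
  boltzmann Q L z = \prod_(x <- M) \prod_(y <- M | outer x y) r (z x) (z y).
Proof.
rewrite (boltzmannE _ LM nbrM).
rewrite [RHS](eq_bigr (fun x =>
    (\prod_(y <- M | outer x y && (choice.pickle x < choice.pickle y)%N) r (z x) (z y)) *
    \prod_(y <- M | outer x y && ~~ (choice.pickle x < choice.pickle y)%N) r (z x) (z y)));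
  last by move=> x _; rewrite (bigID (fun y => choice.pickle x < choice.pickle y)%N).
rewrite big_split/=.
have -> : \prod_(x <- M) \prod_(y <- M | outer x y && ~~ (choice.pickle x < choice.pickle y)%N)
      r (z x) (z y) =
    \prod_(x <- M) \prod_(y <- M | outer x y && (choice.pickle x < choice.pickle y)%N)
      r (z x) (z y).
  under eq_bigr do rewrite big_mkcond.
  under [RHS]eq_bigr do rewrite big_mkcond.
  rewrite exchange_big/=; apply: eq_bigr => x _; apply: eq_bigr => y _.
  rewrite /outer adj_sym r_sym orbC; have [xy|//] := boolP (adj G x y).
  have : choice.pickle x != choice.pickle y.
    apply: contraTneq xy => /(pcan_inj choice.pickleK) ->.
    by rewrite (@adj_irr _ G).
  by move=> /negPf pxy; rewrite -leqNgt leq_eqVlt pxy.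
rewrite -big_split/=; apply: eq_bigr => x _; rewrite -big_split/=.
by apply: eq_bigr => y _; rewrite -rQ expr2.
Qed.

Lemma tree_weight_boltzmann : exists f : config G k -> R,
  [/\ forall z, 0 < f z,
      forall w z, (forall x, x \in M -> x \notin L -> w x = z x) -> f w = f z
    & forall z, tree_weight pi g r M z = boltzmann Q L z * f z].
Proof.
exists rest; split=> // z; rewrite /rest mulrC boltzmann_outer -mulrA -big_split/=.
rewrite /tree_weight.
have -> : \prod_(x <- M) (\prod_(y <- M | inner x y) r (z x) (z y) *
      \prod_(y <- M | outer x y) r (z x) (z y)) =
    \prod_(x <- M) \prod_(y <- M | adj G x y) r (z x) (z y).
  apply: eq_bigr => x _.
  by rewrite mulrC [RHS](bigID (fun y => (x \in L) || (y \in L))).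
rewrite -big_split/=; apply: eq_big_seq => x xM; rewrite big_split/= mulrA.
congr (_ * _); case: ifPn => // xL.
(* All d + 1 neighbours of x lie in M, so g(z x) occurs exactly d + 1 times and combines with pi(z
   x) to [kappa]. *)
rewrite -(pi_g (z x)) big_const_seq (card_neighbours (@nbrM x ^~ xL)).
by rewrite iter_mulr mulr1.
Qed.

End weight.

(** It suffices to test cylinders over connected M containing L and its neighbours. There the kernel
    is a constant times the indicator of the event [C] fixing the spins on M off L, and the mass of
    [C] is f(w) Z_L(w), so the partition function cancels. *)
Lemma tree_measure_gibbs (mu : probability (mconfig G k) R) :
  (forall (L : {fset G}) x, fconnected L -> x \in L -> forall w,
    mu (cylinder L w) = (tree_weight pi g r L w)%:E) ->
  gibbs_measure Q mu.
Proof.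
move=> muE L A mA.
have [M0 [LM0 nbrM0]] := closed_neighbourhood L.
have [root _] := fset_notin (fset0 : {fset G}).
pose nu := gibbs_average Q L mu.
pose nuM := HB.pack_for {measure set (mconfig G k) -> \bar R} nu
  (isMeasure.Build _ _ _ nu (gibbs_average0 _ _ _) (gibbs_average_ge0 LM0 nbrM0 Q_gt0 mu)
    (@gibbs_average_sigma_additive R d G k Q L M0 LM0 nbrM0 Q_gt0 mu)).
suff : mu A = nuM A by [].
apply: (large_cylinder_measure_unique root (L0 := M0)) mA => [M x w cM xM M0M|]; last first.
  exact: (le_lt_trans (probability_le1 mu measurableT) (ltry _)).
have LM : {subset L <= M} by move=> y /LM0 /M0M.
have nbrM y z : y \in L -> adj G y z -> z \in M by move=> yL yz; apply/M0M/(nbrM0 _ _ yL yz).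
have [f [f_gt0 f_local fE]] := tree_weight_boltzmann LM nbrM.
have muM z : mu (cylinder M z) = (boltzmann Q L z * f z)%:E by rewrite (muE M x)// fE.
change (mu (cylinder M w) = \int[mu]_z gibbs_kernel Q L (cylinder M w) z)%E.
pose C := cylinder (M `\` L)%fset w.
have mC : measurable C by exact: measurable_cylinder.
have inC z : C z <-> forall y, y \in M -> y \notin L -> z y = w y.
  by split=> zw y; [move=> yM yL|rewrite in_fsetD => /andP[yL yM]]; apply: zw;
    rewrite ?in_fsetD ?yL.
have CE : mu C = ((f w)%:E * partition_function Q L w)%E.
  have -> : C = \bigcup_(zeta : {ffun L -> 'rV[int]_k}) cylinder M (patch zeta w).
    apply/seteqP; split=> [z /inC zw|z [zeta _ zzeta]].
      exists [ffun y => z (val y)] => // y yM.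
      have [yL|yL] := boolP (y \in L); first by rewrite patch_restrict.
      by rewrite patch_out// zw.
    by apply/inC => y yM yL; rewrite zzeta// patch_out.
  rewrite measure_esum; last 2 first.
  - by move=> zeta; exact: measurable_cylinder.
  - move=> zeta zeta' _ _ [z [zz zz']]; apply/ffunP => y.
    have yM : val y \in M by apply: LM; exact: valP.
    by have := zz _ yM; rewrite zz'// /patch valK.
  rewrite partition_functionE -esumZl ?ltW//; last first.
    by move=> zeta; rewrite lee_fin ltW// (boltzmann_gt0 LM0 nbrM0).
  apply: eq_esum => zeta _; apply: (etrans (muM _)); rewrite -EFinM mulrC.
  by congr (_ * _)%:E; apply: f_local => y yM yL; rewrite patch_out.
(* The partition function is finite at w because f(w) Z_L(w) is the probability of [C] and f(w) >
   0. *)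
have [Z [Z_gt0 ZE]] : exists Z : R, 0 < Z /\ partition_function Q L w = Z%:E.
  have := partition_function_gt0 LM0 nbrM0 Q_gt0 w.
  have : (mu C <= 1)%E by exact: probability_le1.
  rewrite CE; case: (partition_function Q L w) => [Z _ Z0| |//]; first by exists Z.
  by rewrite gt0_muley ?lte_fin.
have kE z : gibbs_kernel Q L (cylinder M w) z
    = ((boltzmann Q L w / Z)%:E * (\1_C z)%:E)%E.
  rewrite /gibbs_kernel indicE; have [/set_mem/inC zw|zC] := boolP (z \in C).
    have -> : partition_function Q L z = Z%:E.
      rewrite -ZE; apply: (partition_function_local _ LM0 nbrM0) => y yM0 yL.
      by rewrite zw ?M0M.
    (* The only configuration that agrees with z off L and with w on M. *)
    pose z0 := patch [ffun y : L => w (val y)] z.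
    rewrite (_ : _ `&` _ = [set z0]); last first.
      apply/seteqP; split=> [z1 [z1z z1w]|_ ->].
        apply/funext => y; rewrite /z0; have [yL|yL] := boolP (y \in L).
          by rewrite patch_restrict// z1w// LM.
        by rewrite patch_out// z1z.
      split=> y yL; first by rewrite /z0 patch_out.
      rewrite /z0; have [yL'|yL'] := boolP (y \in L); first by rewrite patch_restrict.
      by rewrite patch_out// zw.
    rewrite esum_set1; last by rewrite lee_fin ltW// (boltzmann_gt0 LM0 nbrM0).
    rewrite mule1 inver gt_eqF// -EFinM; congr (_ * _)%:E.
    apply: (boltzmann_local _ LM nbrM) => y yM; rewrite /z0.
    have [yL|yL] := boolP (y \in L); first by rewrite patch_restrict.
    by rewrite patch_out// zw.
  rewrite (_ : _ `&` _ = set0) ?esum_set0 ?mul0e ?mule0//.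
  apply/seteqP; split=> // z1 [z1z z1w]; apply: (negP zC); apply/mem_set/inC => y yM yL.
  by rewrite -z1z// z1w.
under eq_integral do rewrite kE.
rewrite ge0_integralZl//; last 2 first.
- by apply/measurable_EFinP; exact: measurable_indic.
- by rewrite lee_fin divr_ge0 ?ltW// (boltzmann_gt0 LM0 nbrM0).
rewrite integral_indic// setIT.
transitivity ((boltzmann Q L w / Z)%:E * mu C)%E; last by [].
by rewrite muM CE ZE -!EFinM (mulrC (f w)) mulrA mulfVK ?gt_eqF.
Qed.

End tree_gibbs.

(** * The measures and the threshold degree *)

Section boundary_law_gibbs.
Context {R : realType} {d : nat} (G : cayley_tree d) {k : nat}.
Variables (Q u : 'rV[int]_k -> R) (c Z : R).
Hypothesis Q_gt0 : forall j, 0 < Q j.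
Hypothesis Q_sym : forall j, Q (- j) = Q j.
Hypothesis u_gt0 : forall j, 0 < u j.
Hypothesis c_gt0 : 0 < c.
Hypothesis Z_gt0 : 0 < Z.
Hypothesis u_sum : (\esum_(j in setT) (u j ^+ d.+1)%:E = Z%:E)%E.
Hypothesis u_law : forall a,
  (\esum_(b in setT) (Q (a - b) * u b ^+ d)%:E = (c * u a)%:E)%E.

Lemma boundary_law_gibbs : exists mu : probability (mconfig G k) R,
  [/\ aut_invariant mu, gibbs_measure Q mu &
      forall x j, mu [set w : config G k | w x = j] = (u j ^+ d.+1 / Z)%:E].
Proof.
(* This normalisation turns pi(b) g(b) g(a) Q(a - b) into Q(a - b) u(b)^d / (c u(a)), which sums to
   one over b by the boundary law equation. *)
pose s := Num.sqrt (Z / c).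
have s2 : s ^+ 2 = Z / c by rewrite sqr_sqrtr// divr_ge0 ?ltW.
have s_gt0 : 0 < s by rewrite sqrtr_gt0 divr_gt0.
pose pi a := u a ^+ d.+1 / Z; pose g a := s / u a.
pose r a b := Num.sqrt (Q (a - b)).
have pi_gt0 a : 0 < pi a by rewrite divr_gt0 ?exprn_gt0.
have g_gt0 a : 0 < g a by rewrite divr_gt0.
have r_gt0 a b : 0 < r a b by rewrite sqrtr_gt0.
have r_sym a b : r a b = r b a by rewrite /r -Q_sym opprB.
have rQ a b : r a b ^+ 2 = Q (a - b) by rewrite sqr_sqrtr ?ltW.
have pi_sum : (\esum_(a in setT) (pi a)%:E = 1)%E.
  under eq_esum do rewrite /pi mulrC EFinM.
  rewrite esumZl ?invr_ge0 ?ltW//; last by move=> a; rewrite lee_fin exprn_ge0 ?ltW.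
  by rewrite u_sum -EFinM mulVf ?gt_eqF.
have pi_stoch a : (\esum_(b in setT) (pi b * g b * g a * r a b ^+ 2)%:E = 1)%E.
  transitivity (\esum_(b in setT) ((c * u a)^-1%:E * (Q (a - b) * u b ^+ d)%:E))%E.
    apply: eq_esum => b _; rewrite -EFinM rQ /pi /g; congr EFin.
    have ua := u_gt0 a; have ub := u_gt0 b.
    transitivity (s ^+ 2 * u b ^+ d * Q (a - b) / (Z * u a)).
      by rewrite exprS; field; rewrite !gt_eqF.
    by rewrite s2; field; rewrite !gt_eqF.
  rewrite esumZl ?invr_ge0 ?mulr_ge0 ?ltW//.
    by rewrite u_law -EFinM mulVf// gt_eqF// mulr_gt0.
  by move=> b; rewrite lee_fin mulr_ge0 ?exprn_ge0 ?ltW.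
have pi_g a : pi a * g a ^+ d.+1 = s ^+ d.+1 / Z.
  rewrite /pi /g expr_div_n mulrC mulrA mulfVK ?gt_eqF ?exprn_gt0//.
have [root _] := fset_notin (fset0 : {fset G}).
have [mu muE] := tree_measure (fun a => ltW (pi_gt0 a)) (fun a => ltW (g_gt0 a))
  (fun a b => ltW (r_gt0 a b)) r_sym pi_sum pi_stoch root.
exists mu; split.
- by move=> phi phi_aut; exact: tree_measure_invariant phi_aut mu muE.
- exact: tree_measure_gibbs pi_gt0 g_gt0 r_gt0 r_sym rQ pi_g mu muE.
- move=> x j; rewrite -[RHS]/(pi j)%:E -(@tree_weight1 _ _ G _ pi g r x (fun=> j)).
  rewrite -(muE _ x); [|exact: fconnected1|by rewrite inE].
  congr (mu _); apply/seteqP; split=> w /=; first by move=> wx y; rewrite inE => /eqP ->.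
  by move=> /(_ x); apply; rewrite inE.
Qed.

End boundary_law_gibbs.

Lemma lp_norm_transfer_op (R : realType) k (U : 'rV[int]_k -> R) (b p : R) :
  0 < p -> (lp_norm p setT (transfer_op U b) < +oo)%E ->
  exists S : R, 0 <= S /\ (\esum_(j in setT) (expR (- (p * b * U j)))%:E = S%:E)%E.
Proof.
move=> p0; rewrite /lp_norm.
have -> : (\esum_(j in [set: 'rV[int]_k]) (`|transfer_op U b j| `^ p)%:E =
    \esum_(j in [set: 'rV[int]_k]) (expR (- (p * b * U j)))%:E)%E.
  apply: eq_esum => j _; rewrite /transfer_op ger0_norm ?expR_ge0// -expRM.
  by congr (expR _)%:E; ring.
have : (0 <= \esum_(j in [set: 'rV[int]_k]) (expR (- (p * b * U j)))%:E)%E.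
  by apply: esum_ge0 => j _; rewrite lee_fin expR_ge0.
case: (esum _ _) => [S S0 _|_|//]; first by exists S; rewrite -lee_fin.
by rewrite poweRyr ?ltxx// invr_eq0 gt_eqF.
Qed.

Lemma esum_neq0 (R : realType) (V : zmodType) (f : V -> R) :
  (forall j, 0 <= f j) -> f 0 = 1 ->
  (\esum_(j in setT) (f j)%:E = 1 + \esum_(j in [set j : V | j <> 0%R]) (f j)%:E)%E.
Proof.
move=> f0 f1; rewrite (esumID [set 0]); last by move=> j _; rewrite lee_fin.
by rewrite !setTI esum_set1 f1 ?lee_fin.
Qed.

Lemma esum_shift (R : realType) (V : zmodType) (f : V -> \bar R) (i : V) :
  (\esum_(j in setT) f (j - i)%R = \esum_(j in setT) f j)%E.
Proof.
rewrite [RHS](@reindex_esum R V V setT setT (fun j : V => j - i) f)//; split=> //.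
  by move=> x y _ _ /addIr.
by move=> x _; exists (x + i); rewrite ?addrK.
Qed.

Lemma localized_measures (R : realType) (d k : nat) (G : cayley_tree d)
    (root : G) (Q : 'rV[int]_k -> R) (eta : R) : (4 <= d)%N ->
  (forall j, 0 < Q j) -> (forall j, Q j <= 1) -> Q 0 = 1 ->
  (forall j, Q (- j) = Q j) ->
  (\esum_(j in [set j | j <> 0%R]) (Q j ^+ d.-1)%:E <= eta%:E)%E ->
  expR 1 * eta <= (8 * d%:R)^-1 / 2 ->
  exists mu : 'rV[int]_k -> probability (mconfig G k) R,
    [/\ distinct_measures mu,
        forall i, aut_invariant (mu i),
        forall i, gibbs_measure Q (mu i)
      & forall i, (0 < mu i [set w : config G k | w root = i])%E /\
          (mu i [set w : config G k | w root <> i]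
            / mu i [set w : config G k | w root = i] <= (1 * (1 / d%:R))%:E)%E].
Proof.
move=> d4 Q_gt0 Q_le1 Q0 Q_sym Qeta etad.
have dE : d = d.-1.+1 by rewrite prednK// (leq_trans _ d4).
have [u [c []]] := @boundary_law_exists R _ Q d.-1 eta Q_gt0 Q_le1 Q0
  ltac:(by rewrite -ltnS -dE) Qeta ltac:(by rewrite -dE).
rewrite -dE => u0 u_gt0 c_gt0 u_sum u_law.
set del := (\esum_(j in _) _)%E in u_sum.
have up_ge0 j : 0 <= u j ^+ d.+1 by rewrite exprn_ge0 ?ltW.
have d_gt0 : (0 : R) < d%:R by rewrite ltr0n (leq_trans _ d4).
have [x [x0 xd delE]] : exists x : R, [/\ 0 <= x, x <= (8 * d%:R)^-1 & del = x%:E].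
  have : (0 <= del)%E by apply: esum_ge0 => j _; rewrite lee_fin.
  by case: del u_sum => [x| |]// xd x0; exists x.
have x1 : x < 1.
  apply: (le_lt_trans xd); rewrite invf_lt1 ?mulr_gt0//.
  have : (1 : R) <= d%:R by rewrite ler1n (leq_trans _ d4).
  lra.
(* The spin 0 contributes u(0)^(d+1) = 1, all the others together x <= 1 / (8 d). *)
pose Z := 1 + x; have Z_gt0 : 0 < Z by rewrite /Z; lra.
have uZ i : (\esum_(j in setT) (u (j - i) ^+ d.+1)%:E = Z%:E)%E.
  rewrite (esum_shift (fun j => (u j ^+ d.+1)%:E)) (esum_neq0 (f := fun j => u j ^+ d.+1))//.
    by rewrite -/del delE.
  by rewrite u0 expr1n.
have ulaw i a : (\esum_(b in setT) (Q (a - b) * u (b - i) ^+ d)%:E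
    = (c * u (a - i))%:E)%E.
  rewrite -u_law -[RHS](esum_shift _ i); apply: eq_esum => b _.
  by rewrite opprB addrA subrK.
have ex i := boundary_law_gibbs G Q_gt0 Q_sym (fun j => u_gt0 (j - i)) c_gt0
  Z_gt0 (uZ i) (ulaw i).
pose mu i := projT1 (cid (ex i)).
have muP i : [/\ aut_invariant (mu i), gibbs_measure Q (mu i) &
    forall x j, mu i [set w : config G k | w x = j] = (u (j - i) ^+ d.+1 / Z)%:E].
  exact: (projT2 (cid (ex i))).
have mui i : mu i [set w : config G k | w root = i] = Z^-1%:E.
  by have [_ _ ->] := muP i; rewrite subrr u0 expr1n mul1r.
exists mu; split.
(* The root carries i with probability 1 / Z under [mu i], but with probability u(i - j)^(d+1) / Z
   <= x / Z < 1 / Z under [mu j]. *)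
- move=> i j ij; exists [set w : config G k | w root = i]; first exact: measurable_coord.
  rewrite mui; have [_ _ ->] := muP j; case => /esym/eqP.
  rewrite -[X in _ == X]mul1r (inj_eq (mulIf _)) ?invr_eq0 ?(gt_eqF Z_gt0)//.
  apply/negP; rewrite lt_eqF//; apply: le_lt_trans x1; rewrite -lee_fin -delE.
  apply: (esum_ge_term (D := [set j | j <> 0]) (fun j => (u j ^+ d.+1)%:E)).
  by move=> /= /eqP; rewrite subr_eq0 => /eqP.
- by move=> i; have [] := muP i.
- by move=> i; have [] := muP i.
- move=> i; rewrite mui; split; first by rewrite lte_fin invr_gt0.
  have -> : [set w : config G k | w root <> i] = ~` [set w : config G k | w root = i] by [].
  rewrite (probability_setC (mu i)); last exact: measurable_coord.
  rewrite mui inver invr_eq0 gt_eqF// invrK -EFinB -EFinM lee_fin.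
  (* The ratio is (1 - 1/Z) Z = Z - 1 = x, so C = 1 is enough. *)
  rewrite (_ : _ * Z = x); last by rewrite mulrBl mul1r mulVf ?gt_eqF// /Z; ring.
  apply: (le_trans xd); rewrite mul1r div1r lef_pV2 ?posrE ?mulr_gt0//; lra.
Qed.

(** * Decay of the sum of Q(j)^(d-1) faster than 1/d *)

Section threshold.
Context {R : realType} {k : nat} (U : 'rV[int]_k -> R) (v A : R) (d1 : nat) (S : R).
Hypothesis v_gt0 : 0 < v.
Hypothesis U_ge : forall j, j <> 0 -> v <= U j.
Hypothesis Av : 1 < A * v.
Hypothesis d1_ge1 : (1 <= d1)%N.
Hypothesis S_sum : (\esum_(j in setT) (expR (- (A / 2 * ln d1%:R * U j)))%:E = S%:E)%E.

Let A_gt0 : 0 < A.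
Proof. by rewrite -(pmulr_lgt0 _ v_gt0) (lt_trans ltr01). Qed.

Let S_ge0 : 0 <= S.
Proof. by rewrite -lee_fin -S_sum; apply: esum_ge0 => j _; rewrite lee_fin expR_ge0. Qed.

(** With rho = (d - 1) / (d + 1), the exponent (d - 1) beta U is at least A rho ln d U. A share A /
    2 ln d1 U of it is kept for the convergent sum [S]; on the rest U >= v yields a factor of order
    d^(- A v rho), where A v rho stays above 1 for large d. *)
Lemma transfer_op_pow_sum : exists n : nat, (4 <= n)%N /\
  forall d, (n <= d)%N -> forall b, beta_min A d <= b -> exists eta : R,
  (\esum_(j in [set j | j <> 0%R]) (transfer_op U b j ^+ d.-1)%:E <= eta%:E)%E /\
  expR 1 * eta <= (8 * d%:R)^-1 / 2.
Proof.
have [al alE] : exists al, al = A * v by exists (A * v).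
have al1 : 1 < al by rewrite alE.
(* [K] collects the factors independent of d; the required bound becomes K d^(1 - al rho) <= 1. *)
pose K := 16 * expR 1 * S * expR (al * ln d1%:R / 2).
have K0 : 0 <= K by rewrite !mulr_ge0 ?expR_ge0.
(* The bound [n1] secures al rho >= (1 + al) / 2, and [n2] secures K <= (al - 1) / 2 * ln d. *)
pose n1 := Num.bound (4 * al / (al - 1)); pose n2 := Num.bound (expR (2 * K / (al - 1))).
exists (maxn 4 (maxn d1 (maxn n1 n2))); split; first exact: leq_maxl.
move=> d; rewrite !geq_max => /and4P[d4 d1d n1d n2d] b bd.
have d_gt0 : (0 : R) < d%:R by rewrite ltr0n (leq_trans _ d4).
have al1' : 0 < al - 1 by rewrite subr_gt0.
have dn1 : 4 * al / (al - 1) <= d%:R.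
  apply: (le_trans (ltW (archi_boundP _))); last by rewrite ler_nat.
  by rewrite divr_ge0 ?mulr_ge0 ?ltW// (lt_trans ltr01).
have lnd : 2 * K / (al - 1) <= ln d%:R.
  rewrite -ler_expR lnK ?posrE//.
  by apply: (le_trans (ltW (archi_boundP (expR_ge0 _)))); rewrite ler_nat.
have lnd0 : 0 <= ln (d%:R : R) by rewrite ln_ge0// ler1n (leq_trans _ d4).
have lnd1d : ln (d1%:R : R) <= ln d%:R by rewrite ler_ln ?posrE// ?ltr0n// ler_nat.
pose rho := d.-1%:R / d.+1%:R : R.
have rhoE : rho = 1 - 2 / d.+1%:R.
  apply: (@mulIf _ d.+1%:R); first by rewrite pnatr_eq0.
  rewrite mulrBl !mulfVK ?pnatr_eq0// mul1r.
  by rewrite -{2}[d](@prednK d) ?(leq_trans _ d4)// -!natr1; ring.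
have d1_gt0 : (0 : R) < d.+1%:R by rewrite ltr0n.
have rho_half : 2^-1 <= rho.
  have : 2 / d.+1%:R <= 2^-1 :> R.
    rewrite ler_pdivrMr// mulrC ler_pdivlMr//.
    by rewrite -natrM ler_nat; move: d4; lia.
  by rewrite rhoE; move: (2 / d.+1%:R : R) => y; lra.
have rho_al : (1 + al) / 2 <= al * rho.
  have : 2 * al / d.+1%:R <= (al - 1) / 2.
    rewrite ler_pdivrMr//; move: dn1; rewrite ler_pdivrMr// -(natr1 d).
    by move: (d%:R : R) => y; nra.
  by rewrite rhoE mulrBr mulr1 (mulrCA al) (mulrA 2); move: (2 * al / _) => y; lra.
pose q := al * rho * ln d%:R - al * ln d1%:R / 2.
have Qle j : j <> 0 -> transfer_op U b j ^+ d.-1 <=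
    expR (- q) * expR (- (A / 2 * ln d1%:R * U j)).
  move=> j0; rewrite /transfer_op -expRM_natl -expRD ler_expR.
  have bU : beta_min A d * d.-1%:R * U j <= b * d.-1%:R * U j.
    apply: ler_wpM2r; first exact: le_trans (ltW v_gt0) (U_ge j0).
    by apply: ler_wpM2r.
  have bE : beta_min A d * d.-1%:R = A * (rho * ln d%:R).
    by rewrite /beta_min /rho; ring.
  (* Nonnegativity of the remaining coefficient, from rho >= 1/2 and d >= d1, is what allows U to be
     replaced there by its lower bound v. *)
  have br : 0 <= rho * ln d%:R - ln d1%:R / 2.
    have := ler_wpM2r lnd0 rho_half; lra.
  have := ler_wpM2l (mulr_ge0 (ltW A_gt0) br) (U_ge j0).
  move: bU; rewrite bE /q alE.
  move: (rho) (ln d%:R : R) (ln d1%:R : R) (d.-1%:R : R) (U j) => x y z t w.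
  lra.
exists (expR (- q) * S); split.
  rewrite EFinM -S_sum -esumZl; [|exact: expR_ge0|by move=> j; rewrite lee_fin expR_ge0].
  rewrite [leRHS](esumID [set j | j <> 0]); last first.
    by move=> j _; rewrite -EFinM lee_fin mulr_ge0 ?expR_ge0.
  rewrite !setTI -[leLHS]adde0 leeD//.
    by apply: le_esum => j j0; rewrite -EFinM lee_fin; exact: Qle.
  by apply: esum_ge0 => j _; rewrite -EFinM lee_fin mulr_ge0 ?expR_ge0.
have -> : (8 * d%:R)^-1 / 2 = (16 * d%:R)^-1 :> R by rewrite -invfM; congr (_^-1); ring.
rewrite -[leRHS]mul1r ler_pdivlMr ?mulr_gt0//.
have -> : expR 1 * (expR (- q) * S) * (16 * d%:R) =
    K * expR (ln d%:R - al * rho * ln d%:R).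
  rewrite [RHS]mulrC expRD lnK ?posrE//.
  have -> : expR (- q) = expR (al * ln d1%:R / 2) * expR (- (al * rho * ln d%:R)).
    by rewrite -expRD; congr expR; rewrite /q; ring.
  by rewrite /K; ring.
(* The two thresholds make the exponent at most - K, and K <= e^K closes the estimate. *)
apply: (@le_trans _ _ (K * expR (- K))).
  rewrite ler_wpM2l// ler_expR.
  have h1 := ler_wpM2r lnd0 rho_al.
  have h2 : K <= (al - 1) / 2 * ln d%:R.
    by move: lnd; rewrite ler_pdivrMr//; lra.
  by move: h1 h2; move: (ln d%:R : R) => y; lra.
rewrite expRN ler_pdivrMr ?expR_gt0// mul1r.
by have := expR_ge1Dx K; lra.
Qed.

End threshold.

Unset Implicit Arguments.
Set Strict Implicit.
Set Printing Implicit Defensive.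

Theorem theorem6 (R : realType) (k : nat) (hk : (1 <= k)%N)
    (U : 'rV[int]_k -> R)
    (U_ge0 : forall j, 0 <= U j)
    (U_sym : forall j, U (- j) = U j)
    (U_0 : U 0 = 0)
    (v : R) (v_def : v = inf [set U j | j in [set j | j <> 0]])
    (v_gt0 : 0 < v)
    (A : R) (hA : 1 / v < A)
    (hQ : exists2 d : nat, (2 <= d)%N &
       (lp_norm (d.+1%:R / 2) [set: 'rV[int]_k]
          (transfer_op U (beta_min A d)) < +oo)%E) :
  exists (d0 : nat) (C : R),
    [/\ (2 <= d0)%N, 0 < C,
        localized_from U A C d0,
        (fun d : nat => C * (1 / d%:R)) @ \oo --> (0 : R)
      & forall (n : nat) (C' : R), (2 <= n)%N -> 0 < C' ->
          localized_from U A C' n -> (d0 <= n)%N].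
Proof.
have [d1 d1_ge2 normQ] := hQ.
have Av : 1 < A * v by rewrite -ltr_pdivrMr.
have A_ge0 : 0 <= A by rewrite -(pmulr_lge0 _ v_gt0) (le_trans ler01) ?ltW.
have U_ge j : j <> 0 -> v <= U j.
  move=> j0; rewrite v_def; apply: ge_inf; last by exists j.
  by exists 0 => _ [i _ <-].
have [|S [_ S_sum]] := @lp_norm_transfer_op _ _ U _ _ _ normQ.
  by rewrite divr_gt0.
(* At p = (d1 + 1) / 2 the product of p with [beta_min A d1] is A / 2 * ln d1, so the norm
   hypothesis is finiteness of this sum. *)
have S_sum' : (\esum_(j in setT) (expR (- (A / 2 * ln d1%:R * U j)))%:E = S%:E)%E.
  have -> : A / 2 * ln d1%:R = d1.+1%:R / 2 * beta_min A d1.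
    have : d1.+1%:R != 0 :> R by rewrite pnatr_eq0.
    rewrite /beta_min; move: (d1.+1%:R : R) (ln d1%:R : R) => x y x0.
    by field.
  exact: S_sum.
have [n1 [n1_ge4 etaP]] := transfer_op_pow_sum v_gt0 U_ge Av (ltnW d1_ge2) S_sum'.
have loc1 : localized_from U A 1 n1.
  move=> d n1d b bd G root; have [eta [etaQ etad]] := etaP d n1d b bd.
  have d4 := leq_trans n1_ge4 n1d.
  have b_ge0 : 0 <= b.
    apply: le_trans bd; rewrite divr_ge0 ?mulr_ge0 ?ln_ge0 ?ler1n//.
    exact: leq_trans d4.
  apply: localized_measures d4 _ _ _ _ etaQ etad => [j|j||j]; rewrite /transfer_op.
  - exact: expR_gt0.
  - by rewrite -expR0 ler_expR oppr_le0 mulr_ge0.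
  - by rewrite U_0 mulr0 oppr0 expR0.
  - by rewrite U_sym.
(* The minimal degree is the least n that works with some constant; C is a constant attached to that
   degree and may differ from the 1 obtained at [n1]. *)
pose good n := `[< (2 <= n)%N /\ exists2 C : R, 0 < C & localized_from U A C n >].
have good1 : exists n, good n.
  exists n1; apply/asboolP; split; last by exists 1.
  exact: leq_trans n1_ge4.
case: (ex_minnP good1) => d0 /asboolP[d0_ge2 [C C_gt0 locC]] d0_min.
exists d0, C; split=> //.
- rewrite -(mulr0 C); apply: cvgMr.
  (* The harmonic sequence is 1 / (n + 1), hence the shift of the index by one. *)
  rewrite -(cvg_shiftS (fun d : nat => 1 / d%:R : R)) /=.
  by under eq_fun do rewrite div1r; exact: cvg_harmonic.
- by move=> n C' n2 C'0 locC'; apply: d0_min; apply/asboolP; split=> //; exists C'.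
Qed.
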